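(* Let $n\ge 2$, let $\omega_\Sigma:\mathbb{R}\to\mathbb{R}$ be the profile function of an oscillating cylinder $\Sigma$ satisfying the graph condition $\langle \nu_\Sigma(z),e_1\rangle > C_\Sigma\ge 0$ for all $z$, where $C_\Sigma$ is a constant, and let $\omega_0$ be admissible initial data for the Neumann problem (P). Assume that there is no point $z^*$ with $\omega_\Sigma(z^* )=0$, and that at each of the two ends $z\to+\infty$ and $z\to-\infty$ at least one of the following holds: (i) the limit $\lim_{z\to\pm\infty}\omega_\Sigma(z)$ (with the sign of the end considered) does not exist; (ii) there exists $\alpha$ with $|\alpha|>0$ ($\alpha>0$ for the end $+\infty$, $\alpha<0$ for the end $-\infty$) such that $z\,\frac{d\omega_\Sigma}{dz}(z)>0$ for all $z>\alpha$ if $\alpha>0$, respectively for all $z<\alpha$ if $\alpha<0$. Then the global smooth solution $\omega:D(t)\times[0,\infty)\to\mathbb{R}$ of (P) satisfies $$\lim_{t\to\infty}\ \sup_{y\in[0,r(t)]}\left|\frac{d\omega}{dy}(y,t)\right|=0,$$ that is, the solution converges to a flat disk as $t\to\infty$.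
   Context: Points of $\mathbb{R}^{n+1}$ are written $(x,z)$, $x\in\mathbb{R}^n$, $z\in\mathbb{R}$, and $y=|x|$. $Oz$ is the $z$-axis. Oscillating cylinder: the rotationally symmetric hypersurface $\Sigma=\{(x,z):|x|=\omega_\Sigma(z)\}$ generated by the (smooth) graph of a function $\omega_\Sigma:\mathbb{R}\to\mathbb{R}$ over $Oz$. In the profile plane with coordinates $(y,z)$ its unit normal, pointing away from the interior of the evolving hypersurface, is $\nu_\Sigma=\frac{1}{\sqrt{1+(\omega_\Sigma')^2}}(1,-\omega_\Sigma')$ and $e_1=(1,0)$ is the direction of the $y$-axis. Condition (i) means that there is no finite limit; divergence to infinity counts as non-existence of the limit. Neumann problem (P): find $r(t)>0$, $D(t)=(0,r(t))$, and $\omega:D(t)\times[0,T)\to\mathbb{R}$ such that (1) $\frac{\partial\omega}{\partial t}=\frac{d^2\omega}{dy^2}\frac{1}{1+(d\omega/dy)^2}+\frac{d\omega}{dy}\frac{n-1}{y}$ on $(0,r(t))\times[0,T)$; (2) $r(t)=\omega_\Sigma(\omega(r(t),t))$ and $\langle\nu_\omega,\nu_\Sigma\rangle=0$ at $y=r(t)$, where $\nu_\omega=\frac{1}{\sqrt{1+(d\omega/dy)^2}}\left(-\frac{d\omega}{dy},1\right)$ (equivalently $\frac{d\omega}{dy}(r(t),t)=-\frac{d\omega_\Sigma}{dz}(\omega(r(t),t))$); (3) $\lim_{y\to0}\frac1y\frac{d\omega}{dy}(y,t)$ exists; (4) $\omega(y,0)=\omega_0(y)$ on $(0,r(0))$.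 Admissible initial data: $\omega_0:(0,r(0))\to\mathbb{R}$, $\omega_0\in C^2((0,r(0)))$, generating the initial graph, with $r(0)=\omega_\Sigma(\omega_0(r(0)))$ and $\langle\nu_{\omega_0},\nu_\Sigma\rangle=0$ at $r(0)$. The hypersurfaces $F(x,t)=(x,\omega(|x|,t))$ generated by a solution of (P) solve mean curvature flow with free boundary on $\Sigma$. Under the stated hypotheses a global smooth solution (defined for all $t\in[0,\infty)$) exists. *)

(* Defs.v *)
From mathcomp Require Import all_boot all_order all_algebra.
From mathcomp Require Import all_classical all_reals all_analysis.
Set Implicit Arguments.
Unset Strict Implicit.
Unset Printing Implicit Defensive.
Import Order.TTheory GRing.Theory Num.Theory.
Import numFieldNormedType.Exports.

Local Open Scope ring_scope.
Local Open Scope classical_set_scope.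

(* Derivative relative to a set D: two-sided at interior points of D, one-sided
   at the end points of an interval.  Functions are total here; their values
   outside D are irrelevant. *)
Definition is_derive_on (R : realType) (D : set R) (f : R -> R) (x l : R) : Prop :=
  (f z - f x) / (z - x) @[z --> within D x^'] --> l.

Definition derive_on (R : realType) (D : set R) (f : R -> R) (x : R) : R :=
  lim ((f z - f x) / (z - x) @[z --> within D x^']).

(* Vectors of the profile plane, in the coordinates (y, z). *)
Definition dot (R : realType) (u v : R * R) : R := u.1 * v.1 + u.2 * v.2.

Definition e1 (R : realType) : R * R := (1, 0).

Definition nu_Sigma (R : realType) (wS : R -> R) (z : R) : R * R :=
  let s := Num.sqrt (1 + derive1 wS z ^+ 2) in (1 / s, - derive1 wS z / s).

(* Normal of the graph of a function of y whose slope at the given point is p. *)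
Definition nu_graph (R : realType) (p : R) : R * R :=
  let s := Num.sqrt (1 + p ^+ 2) in (- p / s, 1 / s).

Definition smooth (R : realType) (f : R -> R) : Prop :=
  forall (k : nat) (x : R), derivable (derive1n k f) x 1.

Definition C2_on (R : realType) (D : set R) (f : R -> R) : Prop :=
  (forall x, D x -> derivable f x 1 /\ derivable (derive1 f) x 1) /\
  {within D, continuous (derive1n 2 f)}.

(* The graph of f over (0, b) ends on Sigma at y = b and is orthogonal to it. *)
Definition orthogonal_at (R : realType) (wS f : R -> R) (b : R) : Prop :=
  b = wS (f b) /\
  exists2 p : R, is_derive_on `[0, b] f b p
               & dot (nu_graph p) (nu_Sigma wS (f b)) = 0.

Definition admissible (R : realType) (wS : R -> R) (r0 : R) (w0 : R -> R) : Prop :=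
  [/\ 0 < r0, C2_on `]0, r0[ w0 & orthogonal_at wS w0 r0].

(* f is C^infinity on the open set U, and all its partial derivatives extend
   continuously to K, a subset of the closure of U: d i j is the (extension of
   the) derivative of order i in the first and j in the second variable. *)
Definition smooth_up_to (R : realType) (U K : set (R * R)) (f : R * R -> R) : Prop :=
  exists d : nat -> nat -> R * R -> R,
    (forall p, K p -> d 0%N 0%N p = f p) /\
    forall i j : nat,
      {within K, continuous (d i j)} /\
      forall y t : R, U (y, t) ->
        is_derive y 1 (fun y' => d i j (y', t)) (d i.+1 j (y, t)) /\
        is_derive t 1 (fun t' => d i j (y, t')) (d i j.+1 (y, t)).

(* Global solutions of the Neumann problem, of class C^infinity for t > 0 up to
   y = 0 and y = r(t), and continuous up to t = 0, where the initial datum is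
   only C^2.  At t = 0 the time derivative in the equation is one-sided. *)
Record global_smooth_solution (R : realType) (n : nat) (wS : R -> R)
    (r0 : R) (w0 : R -> R) (r : R -> R) (w : R -> R -> R) : Prop := {
  sol_r_gt0 : forall t, 0 <= t -> 0 < r t;
  sol_r_cont : {within `[0, +oo[, continuous r};
  sol_r_smooth : forall (k : nat) (t : R), 0 < t -> derivable (derive1n k r) t 1;
  sol_cont : {within [set p : R * R | 0 <= p.2 /\ 0 <= p.1 <= r p.2],
                continuous (fun p => w p.1 p.2)};
  sol_smooth : smooth_up_to [set p : R * R | 0 < p.2 /\ 0 < p.1 < r p.2]
                            [set p : R * R | 0 < p.2 /\ 0 <= p.1 <= r p.2]
                            (fun p => w p.1 p.2);
  sol_eq : forall y t, 0 <= t -> 0 < y < r t ->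
    is_derive_on `[0, +oo[ (w y) t
      (derive1n 2 (w ^~ t) y * (1 / (1 + derive1 (w ^~ t) y ^+ 2))
       + derive1 (w ^~ t) y * ((n%:R - 1) / y));
  sol_bdry : forall t, 0 <= t -> orthogonal_at wS (w ^~ t) (r t);
  sol_axis : forall t, 0 <= t ->
    exists l : R, (1 / y) * derive1 (w ^~ t) y @[y --> 0^'+] --> l;
  sol_init_r : r 0 = r0;
  sol_init : forall y, 0 < y < r0 -> w y 0 = w0 y
}.

Definition end_condition_pinfty (R : realType) (wS : R -> R) : Prop :=
  ~ (exists l : R, wS z @[z --> +oo] --> l) \/
  exists2 alpha : R, 0 < alpha & forall z, alpha < z -> 0 < z * derive1 wS z.

Definition end_condition_ninfty (R : realType) (wS : R -> R) : Prop :=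
  ~ (exists l : R, wS z @[z --> -oo] --> l) \/
  exists2 alpha : R, alpha < 0 & forall z, z < alpha -> 0 < z * derive1 wS z.

(* Main.v *)
Require Import Defs.
From mathcomp Require Import all_boot all_order all_algebra.
From mathcomp Require Import all_classical all_reals all_analysis.
From mathcomp Require Import ring lra.
Import Order.TTheory GRing.Theory Num.Theory.
Import numFieldNormedType.Exports.
Local Open Scope ring_scope.
Local Open Scope classical_set_scope.

(** Everything is deduced from the maximum principle and from the decay of area.

    Heights.  The profile of the cylinder is positive, so that either form of the end
    condition yields arbitrarily high points at which it is increasing and arbitrarily
    low points at which it is decreasing ([rising_above], [falling_below]): otherwise
    it would be monotone near an end and have a limit there.  Nearly horizontal cones at
    such heights are barriers ([bounded_above]), so the height stays in a compact
    interval, on which the profile is bounded, bounded away from zero and has a Lipschitz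
    slope.

    From boundary slope to slope.  The slope [v] of the disk satisfies a parabolic equation
    with the zero order term [- (n - 1) v / y^2], it vanishes on the axis, and on the
    cylinder it is minus the slope of the profile.  A barrier that decreases
    exponentially in time shows that a bound on the boundary slope is inherited by [v] as
    [t] tends to infinity ([slope_above]).  This bounds the gradient, and it
    reduces the theorem to the convergence of the boundary slope to zero.

    The boundary slope.  As the disk meets the cylinder orthogonally, the derivative of its
    area is minus the integral of the squared mean curvature.  On the other hand
    [y^(n-1) v / sqrt (1 + v^2)] is the integral from [0] to [y] of the mean curvature
    times [s^(n-1) ds], whence a bound of [v] by the dissipation of area
    ([area_dissipation]).  Area being nonnegative, every late time interval of
    a given length contains a time at which the dissipation is as small as desired
    ([small_dissipation]); at that time the disk is nearly flat and its boundary slope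
    nearly zero ([nearly_flat]).  Starting from such a time, a parabola with vertex
    near the cylinder is a barrier that keeps the boundary height almost fixed for a
    uniform amount of time ([boundary_height_rise]).  So the slope of the profile at
    the boundary height is small at all late times ([slope_vanishes]).

    These arguments are carried out for the pull-back of the solution to the fixed segment
    [0, 1] by [y = x * r t] (record [flow], lemma [solution_flow]). *)

Set Implicit Arguments.
Unset Strict Implicit.
Unset Printing Implicit Defensive.

(** * Calculus of one variable *)

Section DerivRules.
Context {R : realType}.
Implicit Types (f g : R -> R) (x a b : R).

(** First-order expansion with explicit [e] and [d], the form in which derivatives
    are compared with the one-sided quotients of [is_derive_on]. *)
Lemma is_derive_epsP f x a : is_derive x 1 f a <->
  forall e, 0 < e -> exists2 d, 0 < d &
    forall z, `|z - x| < d -> `|f z - f x - a * (z - x)| <= e * `|z - x|.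
Proof.
have E : (is_derive x 1 f a) <->
   (h^-1 *: (f (h + x) - f x) @[h --> 0^'] --> a).
  split.
    move=> [/= df <-]; move: df; rewrite /derivable /derive /=.
    by under eq_fun do rewrite [_ *: 1]mulr1.
  move=> H.
  have H' : h^-1 *: ((f \o shift x) (h *: 1) - f x) @[h --> 0^'] --> a.
    by rewrite /=; under eq_fun do rewrite [_ *: 1]mulr1.
  apply: DeriveDef; first by apply/cvg_ex; exists a.
  by apply/cvg_lim.
rewrite E; split.
  move=> H e e0.
  move/cvgrPdist_le : H => /(_ e e0) [d /= d0 B]; exists d => // z zd.
  have [->|zx] := eqVneq z x; first by rewrite !subrr mulr0 subr0 !normr0 mulr0.
  have := B (z - x); rewrite /ball /= sub0r normrN subrK => /(_ zd).
  rewrite subr_eq0 => /(_ zx) B'.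
  have zx0 : 0 < `|z - x| by rewrite normr_gt0 subr_eq0.
  have -> : f z - f x - a * (z - x) = - ((a - (z - x)^-1 *: (f z - f x)) * (z - x)).
    by rewrite /GRing.scale /=; field; rewrite subr_eq0.
  by rewrite normrN normrM ler_wpM2r // ltW.
move=> H; apply/cvgrPdist_le => e e0.
have [d d0 B] := H e e0.
exists d => //= h.
rewrite /ball /= sub0r normrN => hd h0.
have := B (h + x); rewrite addrK => /(_ hd) B'.
have h0' : 0 < `|h| by rewrite normr_gt0.
rewrite -(ler_pM2r h0') -normrM.
suff -> : (a - h^-1 *: (f (h + x) - f x)) * h = - (f (h + x) - f x - a * h) by rewrite normrN.
by rewrite /GRing.scale /=; field.
Qed.

(** Derivation rules on explicit lambda terms, applied syntactically by the tactic
    [der] below. *)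
Lemma der_cst (c : R) x : is_derive x 1 (fun _ : R => c) 0.
Proof. exact: is_derive_cst. Qed.
Lemma der_id x : is_derive x 1 (fun z : R => z) 1.
Proof. exact: is_derive_id. Qed.
Lemma derD f g x a b : is_derive x 1 f a -> is_derive x 1 g b ->
  is_derive x 1 (fun z => f z + g z) (a + b).
Proof. by move=> ? ?; exact: is_deriveD. Qed.
Lemma derN f x a : is_derive x 1 f a -> is_derive x 1 (fun z => - f z) (- a).
Proof. by move=> ?; exact: is_deriveN. Qed.
Lemma derM f g x a b : is_derive x 1 f a -> is_derive x 1 g b ->
  is_derive x 1 (fun z => f z * g z) (f x * b + g x * a).
Proof. by move=> ? ?; exact: is_deriveM. Qed.
Lemma derX f n x a : is_derive x 1 f a ->
  is_derive x 1 (fun z => f z ^+ n) (n%:R * f x ^+ n.-1 * a).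
Proof.
move=> df; have := is_deriveX n df.
suff -> : f ^+ n = (fun z => f z ^+ n) by [].
by apply/funext => z; rewrite exprfctE.
Qed.
Lemma derV f x a : f x != 0 -> is_derive x 1 f a ->
  is_derive x 1 (fun z => (f z)^-1) (- (f x) ^- 2 * a).
Proof. by move=> ? ?; exact: is_deriveV. Qed.
Lemma der_comp f g x a b : is_derive (g x) 1 f a -> is_derive x 1 g b ->
  is_derive x 1 (fun z => f (g z)) (a * b).
Proof. by move=> ? ?; exact: (@is_derive1_comp _ f g). Qed.
Lemma der_sqrt g x b : 0 < g x -> is_derive x 1 g b ->
  is_derive x 1 (fun z => Num.sqrt (g z)) ((2 * Num.sqrt (g x))^-1 * b).
Proof. by move=> gx dg; apply: der_comp => //; exact: is_derive1_sqrt. Qed.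
Lemma der_exp g x b : is_derive x 1 g b ->
  is_derive x 1 (fun z => expR (g z)) (expR (g x) * b).
Proof. by move=> dg; apply: der_comp => //; exact: is_derive_expR. Qed.

Lemma der_ext f g x a : (\near x, f x = g x) -> is_derive x 1 f a ->
  is_derive x 1 g a.
Proof. exact: near_eq_is_derive. Qed.

Lemma der_cont f x a : is_derive x 1 f a -> {for x, continuous f}.
Proof. by move=> [df _]; exact/differentiable_continuous/derivable1_diffP. Qed.

Lemma der_uniq f x a b : is_derive x 1 f a -> is_derive x 1 f b -> a = b.
Proof. by move=> [_ <-] [_ <-]. Qed.

Lemma mvt f df (a b : R) : a < b -> (forall x, a < x < b -> is_derive x 1 f (df x)) ->
  {within `[a, b], continuous f} ->
  exists2 c, a < c < b & f b - f a = df c * (b - a).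
Proof.
move=> ab fd cf; have fd' x : x \in `]a, b[%R -> is_derive x 1 f (df x).
  by rewrite in_itv; exact: fd.
have [c cab ->] := MVT ab fd' cf.
by exists c => //; move: cab; rewrite in_itv.
Qed.

Lemma mvtT f df a b : a < b -> (forall x, a < x < b -> is_derive x 1 f (df x)) ->
  continuous f ->
  exists2 c, a < c < b & f b - f a = df c * (b - a).
Proof. by move=> ab fd cf; apply: mvt => //; exact: continuous_subspaceT. Qed.

Lemma mvt_der f df a b : a < b -> (forall x, a <= x <= b -> is_derive x 1 f (df x)) ->
  exists2 c, a < c < b & f b - f a = df c * (b - a).
Proof.
move=> ab fd; apply: mvt => //; first by move=> x /andP[ax xb]; apply: fd; rewrite !ltW.
apply: continuous_in_subspaceT => x; rewrite inE /= in_itv /= => xab.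
exact: der_cont (fd _ xab).
Qed.

(** Mean value theorem with control of the distance of the intermediate point. *)
Lemma mvt_near f df (lo hi a b : R) : lo < a < hi -> lo < b < hi ->
  (forall z, lo < z < hi -> is_derive z 1 f (df z)) ->
  exists2 c, `|c - a| <= `|b - a| & f b - f a = df c * (b - a).
Proof.
move=> /andP[la ah] /andP[lb bh] fd.
have [ba|ab|->] := ltgtP b a; last by exists a; rewrite !subrr ?normr0 // mulr0.
- have fd' z : b <= z <= a -> is_derive z 1 f (df z).
    by move=> /andP[? ?]; apply: fd; apply/andP; split; lra.
  have [c /andP[bc ca] E] := mvt_der ba fd'; exists c.
    by rewrite !ltr0_norm; lra.
  by rewrite -[LHS]opprB E; ring.
- have fd' z : a <= z <= b -> is_derive z 1 f (df z).
    by move=> /andP[? ?]; apply: fd; apply/andP; split; lra.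
  have [c /andP[ac cb] E] := mvt_der ab fd'; exists c => //.
  by rewrite !gtr0_norm; lra.
Qed.

(** First and second derivative tests at an interior maximum. *)
Lemma interior_max f f1 (f2 : R) x a b : a < x < b ->
  (forall z, a < z < b -> is_derive z 1 f (f1 z)) -> is_derive x 1 f1 f2 ->
  (forall z, a < z < b -> f z <= f x) -> f1 x = 0 /\ f2 <= 0.
Proof.
move=> xab df d2 fm; have fx0 : f1 x = 0.
  apply: der_uniq (df _ xab) _; apply: (@derive1_at_max _ f a b).
  - by case/andP: xab => ax xb; exact: ltW (lt_trans ax xb).
  - by move=> t; rewrite in_itv /= => /df [].
  - by rewrite in_itv.
  - by move=> t; rewrite in_itv; exact: fm.
split=> //; rewrite leNgt; apply/negP => f20.
have [d d0 B] := (is_derive_epsP _ _ _).1 d2 (f2 / 2) ltac:(lra).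
case/andP: (xab) => ax xb.
pose z := Num.min (x + d / 2) ((x + b) / 2).
have xz : x < z by rewrite lt_min; apply/andP; split; lra.
have zd : z < x + d by rewrite gt_min; apply/orP; left; lra.
have zb : z < b by rewrite gt_min; apply/orP; right; lra.
have [c /andP[xc cz] E] : exists2 c, x < c < z & f z - f x = f1 c * (z - x).
  by apply: mvt_der => // y /andP[? ?]; apply: df; apply/andP; split; lra.
have f1c : 0 < f1 c.
  have := B c; rewrite fx0 subr0 ger0_norm; last lra.
  by move=> /(_ ltac:(lra)); rewrite ler_norml => /andP[]; nra.
have := fm z; rewrite zb => /(_ ltac:(lra)).
have : 0 < f1 c * (z - x) by apply: mulr_gt0; lra.
lra.
Qed.

Lemma left_max_ge0 f (d t0 t : R) : t0 < t -> is_derive t 1 f d ->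
  (forall s, t0 <= s < t -> f s <= f t) -> 0 <= d.
Proof.
move=> t0t df fm; rewrite leNgt; apply/negP => d0.
have [e e0 B] := (is_derive_epsP _ _ _).1 df (- d / 2) ltac:(lra).
pose s := Num.max (t - e / 2) t0.
have st : s < t by rewrite gt_max; apply/andP; split; lra.
have se : t - e < s by rewrite lt_max; apply/orP; left; lra.
have := B s; rewrite ler0_norm; last lra.
move=> /(_ ltac:(lra)); rewrite ler_norml => /andP[+ _].
have := fm s; rewrite st le_max lexx orbT => /(_ isT).
have : 0 < (- d) * (t - s) by apply: mulr_gt0; lra.
lra.
Qed.

Lemma cont_at_lt0 (g : R -> R) x : {for x, continuous g} -> g x < 0 ->
  exists2 d, 0 < d & forall z, `|z - x| < d -> g z < 0.
Proof.
move=> cg gx; have [d /= d0 B] := cvgr_lt _ cg _ gx.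
by exists d => // z zx; apply: B; rewrite /ball /= distrC.
Qed.

(** Maximum at an end point of [0, 1]: the derivative inside, extended by
    continuity, has the sign of the outward increments. *)
Lemma end_max_right f f1 : continuous f -> {for 1, continuous f1} ->
  (forall x, 0 < x < 1 -> is_derive x 1 f (f1 x)) ->
  (forall x, 0 <= x <= 1 -> f x <= f 1) -> 0 <= f1 1.
Proof.
move=> cf cf1 df fm; rewrite leNgt; apply/negP => /(cont_at_lt0 cf1) [d d0 B].
pose z := Num.max (1 - d / 2) (1 / 2).
have z1 : z < 1 by rewrite gt_max; apply/andP; split; lra.
have zd : 1 - d < z by rewrite lt_max; apply/orP; left; lra.
have z0 : 0 < z by rewrite lt_max; apply/orP; right; lra.
have [c /andP[zc c1] E] : exists2 c, z < c < 1 & f 1 - f z = f1 c * (1 - z).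
  by apply: mvtT => // y /andP[? ?]; apply: df; apply/andP; split; lra.
have := B c; rewrite ltr0_norm; last lra.
move=> /(_ ltac:(lra)).
have := fm z ltac:(apply/andP; split; lra).
by nra.
Qed.

Lemma end_max_left f f1 : continuous f -> {for 0, continuous f1} ->
  (forall x, 0 < x < 1 -> is_derive x 1 f (f1 x)) ->
  (forall x, 0 <= x <= 1 -> f x <= f 0) -> f1 0 <= 0.
Proof.
move=> cf cf1 df fm; rewrite -oppr_ge0 leNgt; apply/negP.
have cN : {for 0, continuous (fun x => - f1 x)} by apply: continuousN.
move=> /(cont_at_lt0 cN) [d d0 B].
pose z := Num.min (d / 2) (1 / 2).
have z1 : 0 < z by rewrite lt_min; apply/andP; split; lra.
have zd : z < d by rewrite gt_min; apply/orP; left; lra.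
have z0 : z < 1 by rewrite gt_min; apply/orP; right; lra.
have [c /andP[zc c1] E] : exists2 c, 0 < c < z & f z - f 0 = f1 c * (z - 0).
  by apply: mvtT => // y /andP[? ?]; apply: df; apply/andP; split; lra.
have := B c; rewrite gtr0_norm; last lra.
move=> /(_ ltac:(lra)).
have := fm z ltac:(apply/andP; split; lra).
by nra.
Qed.

End DerivRules.

(** [der_eq] leaves the value of the derivative to be checked afterwards; [der]
    computes it.  Instance search is bypassed: it would produce values written with
    the scaling of a module instead of the product of the field. *)
Ltac der_eq := notypeclasses refine (is_derive_eq _ _).

Ltac der := cbv beta; repeat (first
  [ notypeclasses refine (der_cst _ _) | notypeclasses refine (der_id _) | eassumption
  | notypeclasses refine (derD _ _) | notypeclasses refine (derN _)
  | notypeclasses refine (derX _ _) | notypeclasses refine (derM _ _)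
  | notypeclasses refine (der_exp _) | notypeclasses refine (der_sqrt _ _)]).

(** * Continuous functions on a rectangle *)

Section Contact.
Context {R : realType}.

(** Joint continuity of a curried function of two variables. *)
Definition jcont (F : R -> R -> R) := continuous (fun p : R * R => F p.1 p.2).

Lemma cont_pair (T U V : topologicalType) (f : T -> U) (g : T -> V) x :
  {for x, continuous f} -> {for x, continuous g} ->
  {for x, continuous (fun x => (f x, g x))}.
Proof. by move=> cf cg; exact: (cvg_pair cf cg). Qed.

Lemma jcont_comp F (T : topologicalType) (f g : T -> R) : jcont F ->
  continuous f -> continuous g -> continuous (fun z => F (f z) (g z)).
Proof.
move=> cF cf cg z.
apply: (@continuous_comp _ _ _ (fun z => (f z, g z)) (fun p => F p.1 p.2)).
  by apply: cont_pair; [exact: cf|exact: cg].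
exact: cF.
Qed.

Lemma jcont_x F t : jcont F -> continuous (fun x => F x t).
Proof.
by move=> cF; apply: jcont_comp => // x; [exact: cvg_id|exact: cvg_cst].
Qed.

Lemma jcont_t F x : jcont F -> continuous (F x).
Proof.
by move=> cF; apply: jcont_comp => // t; [exact: cvg_cst|exact: cvg_id].
Qed.

Lemma rect_compact (a b c d : R) : compact (`[a, b] `*` `[c, d]).
Proof. by apply: compact_setX; exact: segment_compact. Qed.

Lemma rect_max F a b c d : jcont F -> a <= b -> c <= d ->
  exists M, forall x t, a <= x <= b -> c <= t <= d -> F x t <= M.
Proof.
move=> cF ab cd.
have ne : `[a, b] `*` `[c, d] !=set0.
  by exists (a, c); split => /=; rewrite in_itv /= lexx.
have [[x0 t0] _ B] := compact_EVT_max ne (@rect_compact a b c d)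
  (continuous_subspaceT (A := `[a, b] `*` `[c, d]) cF).
exists (F x0 t0) => x t xab tcd; apply: (B (x, t)).
by rewrite inE; split => /=; rewrite in_itv.
Qed.

Lemma seg_max (f : R -> R) a b : continuous f -> a <= b ->
  exists M, forall x, a <= x <= b -> f x <= M.
Proof.
move=> cf ab; have [c _ B] := EVT_max ab (continuous_subspaceT (A := `[a, b]) cf).
by exists (f c) => x xab; apply: B; rewrite in_itv.
Qed.

(** First time at which a function, negative at [T0] on the whole segment,
    vanishes somewhere.  At that time it is nonpositive everywhere, so that the zero
    found is a spatial maximum. *)
Lemma first_contact F T0 T1 : jcont F ->
  (forall x, 0 <= x <= 1 -> F x T0 < 0) ->
  (exists x t, [/\ 0 <= x <= 1, T0 <= t <= T1 & 0 <= F x t]) ->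
  exists x t, [/\ 0 <= x <= 1, T0 < t <= T1, F x t = 0,
    forall x', 0 <= x' <= 1 -> F x' t <= 0 &
    forall x' t', 0 <= x' <= 1 -> T0 <= t' < t -> F x' t' < 0].
Proof.
move=> cF F0 [x1 [t1 [x1b t1b F1]]].
pose Z := (`[0, 1] `*` `[T0, T1]) `&` [set p : R * R | 0 <= F p.1 p.2].
have cZ : compact Z.
  apply: (subclosed_compact _ (@rect_compact 0 1 T0 T1)); last by move=> p [].
  apply: closedI; first exact: compact_closed (@rect_compact 0 1 T0 T1).
  exact: (closed_comp (fun p _ => cF p) (@closed_ge _ 0)).
have neZ : Z !=set0.
  by exists (x1, t1); split => //; split => /=; rewrite in_itv.
have c2 : {within Z, continuous (fun p : R * R => p.2)}.
  by apply: continuous_subspaceT => p; exact: cvg_snd.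
have [[x t]] := compact_EVT_min neZ cZ c2.
rewrite inE => -[[/= xb tb] Fxt] B.
rewrite in_itv /= in xb; rewrite in_itv /= in tb.
have neg x' t' : 0 <= x' <= 1 -> T0 <= t' < t -> F x' t' < 0.
  move=> x'b /andP[t'0 t't]; rewrite ltNge; apply/negP => F'.
  have := B (x', t'); rewrite /= leNgt t't => H.
  have // : false; apply: H; rewrite inE; split => //; split => /=; rewrite in_itv //=.
  by rewrite t'0 /=; case/andP: tb => _; apply: le_trans; exact: ltW.
case/andP: (tb) => T0t tT1.
have T0t' : T0 < t.
  rewrite lt_neqAle T0t andbT; apply/eqP => E.
  by have := F0 _ xb; rewrite E ltNge Fxt.
have np x' : 0 <= x' <= 1 -> F x' t <= 0.
  move=> x'b; rewrite leNgt; apply/negP => F'.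
  have cN : {for t, continuous (fun s => - F x' s)}.
    by apply: continuousN; exact: (jcont_t (x := x') cF).
  have [|d d0 D] := cont_at_lt0 cN; first by rewrite oppr_lt0.
  pose s := Num.max (t - d / 2) T0.
  have st : s < t by rewrite gt_max; apply/andP; split; lra.
  have sd : t - d < s by rewrite lt_max; apply/orP; left; lra.
  have := D s; rewrite ltr0_norm; last lra.
  move=> /(_ ltac:(lra)); rewrite oppr_lt0 => F''.
  have := neg x' s x'b; rewrite st le_max lexx orbT => /(_ isT); lra.
exists x, t; split => //; first by rewrite T0t'.
by apply/eqP; rewrite eq_le np.
Qed.

End Contact.

Arguments jcont_x {R F} t _ _.
Arguments jcont_t {R F} x _ _.

Section JCont.
Context {R : realType}.
Implicit Types F G : R -> R -> R.
Lemma jcont_cst (c : R) : jcont (fun _ _ => c).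
Proof. by move=> p; exact: cvg_cst. Qed.
Lemma jcont_fst : jcont (fun x _ : R => x).
Proof. by move=> p; exact: cvg_fst. Qed.
Lemma jcont_snd : jcont (fun _ t : R => t).
Proof. by move=> p; exact: cvg_snd. Qed.
Lemma jcont1x (f : R -> R) : continuous f -> jcont (fun x _ : R => f x).
Proof.
move=> cf p; apply: (@continuous_comp _ _ _ (fun p : R * R => p.1) f); last exact: cf.
exact: cvg_fst.
Qed.
Lemma jcont1t (f : R -> R) : continuous f -> jcont (fun _ t : R => f t).
Proof.
move=> cf p; apply: (@continuous_comp _ _ _ (fun p : R * R => p.2) f); last exact: cf.
exact: cvg_snd.
Qed.
Lemma jcontD F G : jcont F -> jcont G -> jcont (fun x t => F x t + G x t).
Proof. by move=> cF cG p; apply: continuousD; [exact: cF|exact: cG]. Qed.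
Lemma jcontN F : jcont F -> jcont (fun x t => - F x t).
Proof. by move=> cF p; apply: continuousN; exact: cF. Qed.
Lemma jcontM F G : jcont F -> jcont G -> jcont (fun x t => F x t * G x t).
Proof. by move=> cF cG p; apply: continuousM; [exact: cF|exact: cG]. Qed.
Lemma jcont_comp1 (f : R -> R) F : continuous f -> jcont F -> jcont (fun x t => f (F x t)).
Proof.
move=> cf cF p; apply: (@continuous_comp _ _ _ (fun p : R * R => F p.1 p.2) f).
  exact: cF.
exact: cf.
Qed.
Lemma jcontX F n : jcont F -> jcont (fun x t => F x t ^+ n).
Proof.
by move=> cF; apply: (jcont_comp1 (f := fun z => z ^+ n)) => // z; exact: exprn_continuous.
Qed.
Lemma jcontV F : jcont F -> (forall x t, F x t != 0) -> jcont (fun x t => (F x t)^-1).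
Proof. by move=> cF F0 p; apply: continuousV; [exact: F0|exact: cF]. Qed.
End JCont.

(** Proves joint continuity by matching the syntax of the function. *)
Ltac jc := cbv beta; lazymatch goal with
  | |- jcont (fun _ _ => ?c) => exact (@jcont_cst _ c)
  | |- jcont (fun x _ => x) => exact jcont_fst
  | |- jcont (fun _ t => t) => exact jcont_snd
  | |- jcont (fun x t => @?F x t + @?G x t) => apply (@jcontD _ F G); jc
  | |- jcont (fun x t => - @?F x t) => apply (@jcontN _ F); jc
  | |- jcont (fun x t => @?F x t * @?G x t) => apply (@jcontM _ F G); jc
  | |- jcont (fun x t => @?F x t ^+ ?n) => apply (@jcontX _ F n); jc
  | |- jcont (fun _ t => @?f t) => try (apply (@jcont1t _ f); assumption)
  | |- _ => try assumption
  end.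

(** * Integrals depending on a parameter *)

Section Integrals.
Context {R : realType}.
Notation mu := (@lebesgue_measure R).

Lemma cont_integrable (f : R -> R) a b : continuous f ->
  mu.-integrable `[a, b] (EFin \o f).
Proof.
move=> cf; apply: continuous_compact_integrable; first exact: segment_compact.
exact: continuous_subspaceT.
Qed.

Lemma jcont_near (F : R -> R -> R) x t e : jcont F -> 0 < e ->
  exists2 d, 0 < d & forall y s, `|y - x| < d -> `|s - t| < d -> `|F y s - F x t| <= e.
Proof.
move=> cF e0; have := cF (x, t).
move=> /cvgrPdist_le /(_ e e0) [[A B] /= [[d1 d10 B1] [d2 d20 B2]] AB].
exists (Num.min d1 d2) => [|y s]; first by rewrite lt_min; apply/andP.
rewrite !lt_min => /andP[y1 y2] /andP[s1 s2].
rewrite distrC; apply: (AB (y, s)); split => /=.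
  by apply: B1; rewrite /ball /= distrC.
by apply: B2; rewrite /ball /= distrC.
Qed.

(** A time derivative known for [0 < x < 1] and jointly continuous up to the end points
    is also valid at the end points. *)
Lemma der_closed (F D : R -> R -> R) : jcont F -> jcont D ->
  (forall x t : R, 0 < x < 1 -> 1 < t -> is_derive t 1 (F x) (D x t)) ->
  forall x t : R, 0 <= x <= 1 -> 1 < t -> is_derive t 1 (F x) (D x t).
Proof.
move=> cF cD dF x t xb t1; apply/is_derive_epsP => e e0.
have [d d0 B] := jcont_near x t cD e0.
exists (Num.min d (t - 1)); first by rewrite lt_min d0 subr_gt0.
move=> z; rewrite lt_min => /andP[zd zt].
have z1 : 1 < z by move: zt; rewrite ltr_norml => /andP[+ _]; lra.
have key y : 0 < y < 1 -> `|y - x| < d ->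
    `|F y z - F y t - D x t * (z - t)| <= e * `|z - t|.
  move=> y01 yd.
  have [c cd ->] : exists2 c, `|c - t| < d & F y z - F y t = D y c * (z - t).
    have [||s /andP[s1 _]|c cd E] := @mvt_near _ (F y) (D y) 1 (t + z) t z.
    - by rewrite t1 ltrDl; lra.
    - by rewrite z1 ltrDr; lra.
    - exact: dF.
    - by exists c => //; apply: le_lt_trans cd zd.
  by rewrite -mulrBl normrM; apply: ler_wpM2r => //; apply: B.
rewrite leNgt; apply/negP => big.
pose f y := e * `|z - t| - `|F y z - F y t - D x t * (z - t)|.
have cf : {for x, continuous f}.
  have cFz : {for x, continuous (fun y => F y z - F y t - D x t * (z - t))}.
    have cz : {for x, continuous (fun y => F y z)} := @jcont_x _ F z cF x.
    have ct : {for x, continuous (fun y => F y t)} := @jcont_x _ F t cF x.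
    apply: continuousB; last exact: cvg_cst.
    by apply: continuousB; [exact: cz | exact: ct].
  apply: continuousB; first exact: cvg_cst.
  by apply: (continuous_comp cFz); exact: norm_continuous.
have [|d' d'0 B'] := cont_at_lt0 cf; first by rewrite /f subr_lt0.
pose h := Num.min (1 / 2) (Num.min (d / 2) (d' / 2)).
have h0 : 0 < h by rewrite !lt_min; apply/andP; split; [|apply/andP; split]; lra.
have h1 : h < 1 by rewrite gt_min; apply/orP; left; lra.
have hd : h < d by rewrite !gt_min; apply/orP; right; apply/orP; left; lra.
have hd' : h < d' by rewrite !gt_min; apply/orP; right; apply/orP; right; lra.
pose y := x + h * (1 / 2 - x).
have yx : `|y - x| <= h.
  rewrite /y (addrC x) addrK normrM (gtr0_norm h0) ler_piMr //; first exact: ltW.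
  by rewrite ler_norml; lra.
have y01 : 0 < y < 1 by rewrite /y; apply/andP; split; nra.
have := B' y ltac:(lra); rewrite /f subr_lt0.
by have := key y y01 ltac:(lra); lra.
Qed.

(** Differentiation under the integral sign on [0, 1]. *)
Lemma integral_param (F D : R -> R -> R) (t : R) : jcont F -> jcont D ->
  (forall x t : R, 0 < x < 1 -> 1 < t -> is_derive t 1 (F x) (D x t)) -> 1 < t ->
  is_derive t 1 (fun t => \int[mu]_(x in `[0, 1]) F x t) (\int[mu]_(x in `[0, 1]) D x t).
Proof.
move=> cF cD dF t1; have dF' := der_closed cF cD dF.
pose u := (1 + t) / 2; pose v := t + 1.
have [M MB] := rect_max cD (ler01 : 0 <= 1 :> R) (ltac:(rewrite /u /v; lra) : u <= v).
have [M' M'B] := rect_max (jcontN cD) (ler01 : 0 <= 1 :> R) (ltac:(rewrite /u /v; lra) : u <= v).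
pose f := fun s x => F x s.
have D1 s x : 1 < s -> 0 <= x <= 1 -> partial1of2 f s x = D x s.
  move=> s1 xb; rewrite partial1of2E /f; by have [_ ->] := dF' x s xb s1.
have tI : `]u, v[ t by rewrite /= in_itv /= /u /v; lra.
have mB : measurable (`[0, 1] : set (measurableTypeR R)) by exact: measurable_itv.
have intf x : `]u, v[ x -> mu.-integrable `[0, 1] (EFin \o f x).
  by move=> _; apply: cont_integrable; exact: jcont_x.
have der x y : `]u, v[ x -> `[0, 1] y -> derivable (f ^~ y) x 1.
  rewrite /= !in_itv /= /u /v => xI yI.
  by have [] := dF' y x yI ltac:(lra).
pose G (y : measurableTypeR R) : R := Num.max `|M| `|M'|.
have G0 y : 0 <= G y by rewrite /G le_max normr_ge0.
have iG : mu.-integrable `[0, 1] (EFin \o G).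
  by apply: cont_integrable => y; exact: cvg_cst.
have Gub x y : `]u, v[ x -> `[0, 1] y -> `|partial1of2 f x y| <= G y.
  rewrite /= !in_itv /= => xI yI; have x1 : 1 < x by move: xI; rewrite /u; lra.
  rewrite D1 // /G ler_norml.
  have HM := MB y x yI ltac:(lra); have HM' := M'B y x yI ltac:(lra).
  have a1 := ler_norm M; have a2 := ler_norm M'.
  have b1 : `|M| <= Num.max `|M| `|M'| by rewrite le_max lexx.
  have b2 : `|M'| <= Num.max `|M| `|M'| by rewrite le_max lexx orbT.
  by lra.
have H1 := derivable_under_integral mB tI intf der G0 iG Gub.
have H2 := differentiation_under_integral mB tI intf der G0 iG Gub.
apply: DeriveDef; first exact: H1.
rewrite -derive1E [LHS]H2; apply: eq_Rintegral => y.
by rewrite inE /= in_itv /= => yI; rewrite D1.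
Qed.

(** Antiderivative on [0, 1], obtained by integrating from [-1] so that the end point
    [0] is interior. *)
Lemma antiderivative (g : R -> R) : continuous g -> exists H : R -> R,
  [/\ forall x : R, 0 <= x <= 1 -> is_derive x 1 H (g x) &
      \int[mu]_(x in `[0, 1]) g x = H 1 - H 0].
Proof.
move=> cg; pose H (x : R) : R := \int[mu]_(t in `[-1, x]) g t.
have dH (x : R) : -1 < x < 2 -> is_derive x 1 H (g x).
  move=> /andP[x1 x2].
  have [] := continuous_FTC1_closed x2 (cont_integrable (-1) 2 cg) x1 (cg x).
  rewrite -/H => dH1; rewrite derive1E => dH2.
  exact: DeriveDef dH1 dH2.
exists H; split; first by move=> x xb; apply: dH; lra.
rewrite /Rintegral (@continuous_FTC2 _ g H 0 1) //.
- exact: continuous_subspaceT.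
- have cH x : -1 < x < 2 -> {for x, continuous H} by move=> /dH /der_cont.
  split.
  + by move=> x; rewrite in_itv /= => xb; have [] := dH x ltac:(lra).
  + by apply: cvg_at_right_filter; apply: cH; lra.
  + by apply: cvg_at_left_filter; apply: cH; lra.
- by move=> x; rewrite in_itv /= => xb; rewrite derive1E; have [_ ->] := dH x ltac:(lra).
Qed.

Lemma der_ge_incr (f f' : R -> R) a b : a <= b ->
  (forall x, a <= x <= b -> {for x, continuous f}) ->
  (forall x : R, a < x < b -> is_derive x 1 f (f' x)) ->
  (forall x, a < x < b -> 0 <= f' x) -> f a <= f b.
Proof.
rewrite le_eqVlt => /predU1P[-> //|ab] cf df f0.
have cf' : {within `[a, b], continuous f}.
  by apply: continuous_in_subspaceT => x; rewrite inE /= in_itv /=; exact: cf.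
have [c cb E] := mvt ab df cf'.
rewrite -subr_ge0 E; apply: mulr_ge0; last lra.
exact: f0.
Qed.

End Integrals.

(** * The flow in a fixed domain *)

Section Flow.
Context {R : realType}.

(** Rotationally symmetric mean curvature flow with free boundary, pulled back to the
    fixed segment [0, 1] by [y = x * r t], for times after 1.  [g] is the profile of
    the cylinder and [S] its slope, [r] the radius of the disk and [r'] its speed.  The
    functions [W], [V], [V1], [V2], [U], [Z] are the pull-backs of the height, of its
    [y]-derivatives of order one, two and three, of its time derivative, and of the
    mixed derivative; hence the factors [r t] in the derivatives in [x] and the
    convective terms [x * r' t] in the derivatives in [t].  Continuity is
    required on the whole plane, which costs nothing: clamp [x] to [0, 1] and [t] to
    [1, +oo[. *)
Record flow (n : nat) (g S r r' : R -> R) (W V V1 V2 U Z : R -> R -> R) : Prop := {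
  fl_n : (2 <= n)%N;
  fl_g : forall z : R, is_derive z 1 g (S z);
  fl_g0 : forall z, 0 < g z;
  fl_S : continuous S;
  (* the slope of the cylinder is Lipschitz on bounded intervals *)
  fl_lip : forall a b, exists2 K, 0 < K & forall z z', a <= z <= b -> a <= z' <= b ->
    `|S z - S z'| <= K * `|z - z'|;
  fl_r0 : forall t, 0 < r t;
  fl_rc : continuous r;
  fl_r'c : continuous r';
  fl_rd : forall t : R, 1 < t -> is_derive t 1 r (r' t);
  fl_Wc : jcont W; fl_Vc : jcont V; fl_V1c : jcont V1; fl_Uc : jcont U; fl_Zc : jcont Z;
  fl_Wx : forall x t : R, 0 < x < 1 -> 1 < t -> is_derive x 1 (W ^~ t) (r t * V x t);
  fl_Vx : forall x t : R, 0 < x < 1 -> 1 < t -> is_derive x 1 (V ^~ t) (r t * V1 x t);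
  fl_V1x : forall x t : R, 0 < x < 1 -> 1 < t -> is_derive x 1 (V1 ^~ t) (r t * V2 x t);
  fl_Ux : forall x t : R, 0 < x < 1 -> 1 < t -> is_derive x 1 (U ^~ t) (r t * Z x t);
  fl_Wt : forall x t : R, 0 < x < 1 -> 1 < t ->
    is_derive t 1 (W x) (x * r' t * V x t + U x t);
  fl_Vt : forall x t : R, 0 < x < 1 -> 1 < t ->
    is_derive t 1 (V x) (x * r' t * V1 x t + Z x t);
  (* the flow equation, and its derivative in y *)
  fl_pde : forall x t, 0 < x < 1 -> 1 < t ->
    U x t = V1 x t / (1 + V x t ^+ 2) + (n%:R - 1) * (V x t / (x * r t));
  fl_pdeV : forall x t, 0 < x < 1 -> 1 < t ->
    Z x t = V2 x t / (1 + V x t ^+ 2)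
      - 2 * V x t * V1 x t ^+ 2 / (1 + V x t ^+ 2) ^+ 2
      + (n%:R - 1) * (V1 x t / (x * r t) - V x t / (x * r t) ^+ 2);
  (* symmetry on the axis, orthogonality to the cylinder, end point on the cylinder *)
  fl_axis : forall t, 1 < t -> V 0 t = 0;
  fl_bdry : forall t, 1 < t -> V 1 t = - S (W 1 t);
  fl_end : forall t, 1 < t -> r t = g (W 1 t)
}.

Lemma neg_cont (f : R -> R) : continuous f -> continuous (fun z => f (- z)).
Proof.
move=> cf z; apply: (@continuous_comp _ _ _ (fun z : R => - z) f).
  by apply: continuousN; exact: cvg_id.
exact: cf.
Qed.

(** Reflection in a horizontal plane; every upper bound yields a lower bound. *)
Lemma flow_reflect n g S r r' W V V1 V2 U Z : flow n g S r r' W V V1 V2 U Z ->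
  flow n (fun z => g (- z)) (fun z => - S (- z)) r r' (fun x t => - W x t)
    (fun x t => - V x t) (fun x t => - V1 x t) (fun x t => - V2 x t)
    (fun x t => - U x t) (fun x t => - Z x t).
Proof.
move=> fl; split; try (by case: fl).
- move=> z; have dN : is_derive z 1 (fun z : R => - z) (-1) by der.
  der_eq; first exact: (der_comp (fl_g fl (- z)) dN).
  by ring.
- move=> z; have cS := neg_cont (fl_S fl); apply: (continuousN (f := fun z : R => S (- z))). exact: cS.
- move=> a b; have [K K0 B] := fl_lip fl (- b) (- a); exists K => // z z' zb z'b.
  have -> : - S (- z) - - S (- z') = - (S (- z) - S (- z')) by ring.
  have -> : z - z' = - (- z - - z') by ring.
  by rewrite !normrN; apply: B; lra.
- exact: jcontN (fl_Wc fl).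
- exact: jcontN (fl_Vc fl).
- exact: jcontN (fl_V1c fl).
- exact: jcontN (fl_Uc fl).
- exact: jcontN (fl_Zc fl).
- by move=> x t x01 t1; rewrite mulrN; apply: derN; exact: (fl_Wx fl x01 t1).
- by move=> x t x01 t1; rewrite mulrN; apply: derN; exact: (fl_Vx fl x01 t1).
- by move=> x t x01 t1; rewrite mulrN; apply: derN; exact: (fl_V1x fl x01 t1).
- by move=> x t x01 t1; rewrite mulrN; apply: derN; exact: (fl_Ux fl x01 t1).
- move=> x t x01 t1; rewrite mulrN -opprD; apply: derN; exact: (fl_Wt fl x01 t1).
- move=> x t x01 t1; rewrite mulrN -opprD; apply: derN; exact: (fl_Vt fl x01 t1).
- by move=> x t x01 t1; rewrite sqrrN (fl_pde fl x01 t1); ring.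
- by move=> x t x01 t1; rewrite !sqrrN (fl_pdeV fl x01 t1); ring.
- by move=> t t1; rewrite (fl_axis fl t1) oppr0.
- by move=> t t1; rewrite (fl_bdry fl t1) !opprK.
- by move=> t t1; rewrite opprK (fl_end fl t1).
Qed.

End Flow.

(** * Barriers *)

Section Estimates.
Context {R : realType}.
Variables (n : nat) (g S r r' : R -> R) (W V V1 V2 U Z : R -> R -> R).
Hypothesis fl : flow n g S r r' W V V1 V2 U Z.

Let n2 : @Order.le _ R 2 n%:R. Proof. by rewrite ler_nat (fl_n fl). Qed.
Let n1 : @Order.lt _ R 0 (n%:R - 1). Proof. by have := n2; lra. Qed.

(** Comparison with the upper barrier [al + be y + b y^2 / 2 + ga t].  With [be < 0] it
    cannot touch the disk from above on the axis, and then [n b <= ga] makes it a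
    strict supersolution inside; the last hypothesis excludes contact on the
    cylinder. *)
Lemma quadratic_barrier (al be b ga T0 T1 : R) : 1 < T0 ->
  be < 0 -> 0 <= b -> n%:R * b <= ga ->
  (forall x, 0 <= x <= 1 ->
    W x T0 < al + be * (x * r T0) + b / 2 * (x * r T0) ^+ 2 + ga * T0) ->
  (forall t, T0 < t <= T1 -> W 1 t = al + be * r t + b / 2 * r t ^+ 2 + ga * t ->
    - S (W 1 t) < be + b * r t) ->
  forall x t : R, 0 <= x <= 1 -> T0 <= t <= T1 ->
    W x t < al + be * (x * r t) + b / 2 * (x * r t) ^+ 2 + ga * t.
Proof.
move=> T01 be0 b0 gab ini bd x t xb tb; rewrite ltNge; apply/negP => Wbig.
pose F x t := W x t - (al + be * (x * r t) + b / 2 * (x * r t) ^+ 2 + ga * t).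
have cr := fl_rc fl. have cW := fl_Wc fl. have cV := fl_Vc fl.
have cF : jcont F by rewrite /F; jc.
have F0 y : 0 <= y <= 1 -> F y T0 < 0 by move=> /ini; rewrite /F; lra.
have ex : exists x t, [/\ 0 <= x <= 1, T0 <= t <= T1 & 0 <= F x t].
  by exists x, t; split => //; rewrite /F; lra.
have [z [s [zb sb Fz np neg]]] := first_contact cF F0 ex.
have s1 : 1 < s by lra.
have rs := fl_r0 fl s.
pose F1 y := r s * (V y s - (be + b * (y * r s))).
have dF (y : R) : 0 < y < 1 -> is_derive y 1 (F ^~ s) (F1 y).
  move=> y01; rewrite /F; have dW := fl_Wx fl y01 s1.
  der_eq; first by der.
  by rewrite /F1 /=; field.
have cF1 : continuous F1.
  have : jcont (fun y s => r s * (V y s - (be + b * (y * r s)))) by jc.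
  by move=> /(jcont_x s).
have cFs : continuous (F ^~ s) := jcont_x s cF.
have mx y : 0 <= y <= 1 -> F y s <= F z s by rewrite Fz; exact: np.
have [z0|z0] := eqVneq z 0.
  rewrite {}z0 in mx Fz; have := end_max_left cFs (cF1 0) dF mx.
  rewrite /F1 (fl_axis fl s1) => H.
  have : 0 < r s * (- be) by apply: mulr_gt0; lra.
  by lra.
have [z1|z1] := eqVneq z 1.
  rewrite {}z1 in mx Fz; have := end_max_right cFs (cF1 1) dF mx.
  have := bd s ltac:(lra); rewrite /F !mul1r in Fz.
  move=> /(_ ltac:(lra)); rewrite -(fl_bdry fl s1) => H.
  rewrite /F1 mul1r => H2.
  have : 0 < r s * (be + b * r s - V 1 s) by apply: mulr_gt0; lra.
  by lra.
have z01 : 0 < z < 1 by case/andP: zb => ? ?; rewrite !lt_neqAle z1 eq_sym z0 /=; apply/andP.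
have [F1z F2z] : F1 z = 0 /\ r s ^+ 2 * (V1 z s - b) <= 0.
  apply: (interior_max z01 dF); last by move=> y y01; apply: mx; lra.
  have dV := fl_Vx fl z01 s1; rewrite /F1.
  der_eq; first by der.
  by rewrite /=; ring.
have V1b : V1 z s <= b.
  move: F2z; rewrite pmulr_rle0 ?exprn_gt0 //; lra.
have Vz : V z s = be + b * (z * r s).
  by move/eqP: F1z; rewrite /F1 mulf_eq0 gt_eqF //= => /eqP; lra.
have dFt : is_derive s 1 (F z) (U z s - ga).
  have dW := fl_Wt fl z01 s1; have dr := fl_rd fl s1; rewrite /F.
  der_eq; first by der.
  by rewrite /= Vz; field.
have : 0 <= U z s - ga.
  apply: (left_max_ge0 (t0 := T0) _ dFt); first lra.
  by move=> s' s'b; rewrite Fz; apply: ltW; apply: neg => //; lra.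
rewrite (fl_pde fl z01 s1).
have zr : 0 < z * r s by apply: mulr_gt0 => //; lra.
have H1 : V1 z s / (1 + V z s ^+ 2) <= b.
  have q0 := sqr_ge0 (V z s).
  rewrite ler_pdivrMr; last lra.
  have : 0 <= b * V z s ^+ 2 by apply: mulr_ge0.
  by lra.
have H2 : V z s / (z * r s) < b.
  by rewrite ltr_pdivrMr // Vz; lra.
have : (n%:R - 1) * (V z s / (z * r s)) < (n%:R - 1) * b by rewrite ltr_pM2l.
by lra.
Qed.

(** Heights at which the cylinder opens upwards cannot be passed from below: a cone
    slightly steeper than a horizontal disk is a barrier there. *)
Lemma bounded_above : (forall M, exists2 c, M <= c & 0 < S c) ->
  exists b, forall x t : R, 0 <= x <= 1 -> 2 <= t -> W x t <= b.
Proof.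
move=> hS.
have [m mb] := seg_max (jcont_x 2 (fl_Wc fl)) (ler01 : 0 <= 1 :> R).
have [c cm Sc] := hS (m + 1).
exists c => x T xb T2.
have cS := fl_S fl.
have cSN : {for c, continuous (fun z => S c / 2 - S z)}.
  by apply: continuousB; [exact: cvg_cst|exact: cS].
have [|d d0 B] := cont_at_lt0 cSN; first lra.
have [Rm RmB] := seg_max (fl_rc fl) T2.
have Rm0 : 0 < Rm by apply: lt_le_trans (fl_r0 fl 2) _; apply: RmB; lra.
pose sg := Num.min (d / 2) (1 / 2).
have sg0 : 0 < sg by rewrite lt_min; apply/andP; split; lra.
have sgd : sg < d by rewrite gt_min; apply/orP; left; lra.
have sg1 : sg < 1 by rewrite gt_min; apply/orP; right; lra.
(* the cone c - mu y stays within sg of the height c, where the slope of the cylinder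
   exceeds S c / 2 > mu *)
pose mu := Num.min (sg / Rm) (S c / 4).
have mu0 : 0 < mu by rewrite lt_min divr_gt0 //=; lra.
have muS : mu <= S c / 4 by rewrite ge_min lexx orbT.
have muR : mu * Rm <= sg by rewrite -ler_pdivlMr // ge_min lexx.
have mur t : 2 <= t <= T -> 0 < mu * r t <= sg.
  move=> /RmB rR; have r0 := fl_r0 fl t; have := mulr_gt0 mu0 r0.
  have : mu * r t <= mu * Rm by rewrite ler_pM2l.
  by lra.
have := @quadratic_barrier c (- mu) 0 0 2 T.
move=> /(_ ltac:(lra) ltac:(lra) ltac:(lra) ltac:(lra)) H.
have {H} : W x T < c + - mu * (x * r T) + 0 / 2 * (x * r T) ^+ 2 + 0 * T.
  apply: H => //; last lra.
    move=> y yb; have := mb y yb; have := mur 2 ltac:(lra).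
    have : mu * (y * r 2) <= mu * r 2.
      rewrite mulrCA; apply: ler_piMl; last lra.
      by apply: mulr_ge0; [lra|exact: ltW (fl_r0 fl 2)].
    by lra.
  move=> t tb E; have := mur t ltac:(lra) => mr.
  have := B (W 1 t); rewrite E.
  rewrite ltr0_norm; last lra.
  by move=> /(_ ltac:(lra)); lra.
have : 0 <= mu * (x * r T).
  by apply: mulr_ge0; [lra|apply: mulr_ge0; [lra|exact: ltW (fl_r0 fl T)]].
by lra.
Qed.

(** The slope is driven below the bound [eps] of its boundary values at an exponential
    rate, by the zero order term [- (n - 1) V / y^2] of its equation. *)
Lemma slope_above (eps K la T Rm : R) : 1 < T -> 0 < eps -> 0 < K -> 0 < la ->
  (forall t, T <= t -> r t <= Rm) -> la * Rm ^+ 2 <= n%:R - 1 ->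
  (forall t, T <= t -> - S (W 1 t) <= eps) ->
  (forall x, 0 <= x <= 1 -> V x T < K) ->
  forall x t : R, 0 <= x <= 1 -> T <= t -> V x t <= eps + K * expR (- la * (t - T)).
Proof.
move=> T1 eps0 K0 la0 rR laR bd ini x t xb tb; rewrite leNgt; apply/negP => Vbig.
pose F x t := V x t - (eps + K * expR (- la * (t - T))).
have cV := fl_Vc fl.
have cF : jcont F.
  rewrite /F; apply: jcontD; jc.
  by apply: (jcont_comp1 (f := expR)); [exact: continuous_expR|jc].
have F0 y : 0 <= y <= 1 -> F y T < 0.
  by move=> /ini; rewrite /F subrr mulr0 expR0; lra.
have ex : exists x s, [/\ 0 <= x <= 1, T <= s <= t & 0 <= F x s].
  by exists x, t; split => //; rewrite /F; lra.
have [z [s [zb sb Fz np neg]]] := first_contact cF F0 ex.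
have s1 : 1 < s by lra.
have rs := fl_r0 fl s.
have E0 : 0 < K * expR (- la * (s - T)) by apply: mulr_gt0 => //; exact: expR_gt0.
have z0 : z != 0.
  apply/eqP => z0; move: Fz; rewrite z0 /F (fl_axis fl s1); lra.
have z1 : z != 1.
  apply/eqP => z1; move: Fz; rewrite z1 /F (fl_bdry fl s1).
  by have := bd s ltac:(lra); lra.
have z01 : 0 < z < 1 by case/andP: zb => ? ?; rewrite !lt_neqAle z1 eq_sym z0 /=; apply/andP.
have mx y : 0 <= y <= 1 -> F y s <= F z s by rewrite Fz; exact: np.
have [F1z F2z] : r s * V1 z s = 0 /\ r s ^+ 2 * V2 z s <= 0.
  apply: (@interior_max _ (F ^~ s) (fun y => r s * V1 y s) _ z 0 1) => //.
  - move=> y y01; have dV := fl_Vx fl y01 s1; rewrite /F.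
    by der_eq; [der|rewrite /=; ring].
  - have dV := fl_V1x fl z01 s1.
    by der_eq; [der|rewrite /=; ring].
  - by move=> y y01; apply: mx; lra.
have V1z : V1 z s = 0 by move/eqP: F1z; rewrite mulf_eq0 gt_eqF //= => /eqP.
have V2z : V2 z s <= 0 by move: F2z; rewrite pmulr_rle0 ?exprn_gt0.
have dFt : is_derive s 1 (F z) (Z z s + la * (K * expR (- la * (s - T)))).
  have dV := fl_Vt fl z01 s1; rewrite /F.
  der_eq; first by der.
  by rewrite /= V1z; ring.
have : 0 <= Z z s + la * (K * expR (- la * (s - T))).
  apply: (left_max_ge0 (t0 := T) _ dFt); first lra.
  by move=> s' s'b; rewrite Fz; apply: ltW; apply: neg => //; lra.
rewrite (fl_pdeV fl z01 s1) V1z.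
have zr : 0 < z * r s by apply: mulr_gt0 => //; lra.
have q0 := sqr_ge0 (V z s).
have H1 : V2 z s / (1 + V z s ^+ 2) <= 0 by rewrite pmulr_lle0 // invr_gt0; lra.
have Vz : V z s = eps + K * expR (- la * (s - T)) by move: Fz; rewrite /F; lra.
have H2 : la * V z s <= (n%:R - 1) * (V z s / (z * r s) ^+ 2).
  rewrite mulrA ler_pdivlMr ?exprn_gt0 // mulrAC; apply: ler_wpM2r; first lra.
  apply: le_trans laR; rewrite ler_pM2l // ler_sqr ?nnegrE; last 2 first.
  - exact: ltW.
  - by apply: le_trans (ltW rs) (rR s _); lra.
  apply: le_trans (rR s _); last lra.
  by rewrite ler_piMl; lra.
have H3 : la * V z s = la * eps + la * (K * expR (- la * (s - T))) by rewrite Vz mulrDr.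
have := mulr_gt0 la0 eps0; move: H1 H2; rewrite {}H3.
rewrite expr0n /= !(mulr0, mul0r, subr0, sub0r) mulrN.
set X := _ * (_ / _); set Y := la * (K * _); set A := V2 z s / _.
by move=> H1 H2 H4 H5; lra.
Qed.

End Estimates.

(** * Dissipation of area *)

Section Energy.
Context {R : realType}.
Notation mu := (@lebesgue_measure R).
Variables (n : nat) (g S r r' : R -> R) (W V V1 V2 U Z : R -> R -> R).
Hypothesis fl : flow n g S r r' W V V1 V2 U Z.

(** Time derivative of [r = g (W 1)] on the cylinder, with the slope of the cylinder
    replaced by [- V 1].  It is what makes the boundary term of the first variation of
    area vanish. *)
Lemma end_velocity t : 1 < t -> r' t * (1 + V 1 t ^+ 2) + U 1 t * V 1 t = 0.
Proof.
move=> t1.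
have cW := fl_Wc fl; have cV := fl_Vc fl; have cU := fl_Uc fl; have cr' := fl_r'c fl.
have cD : jcont (fun x t => x * r' t * V x t + U x t) by jc.
have dW := der_closed cW cD (fl_Wt fl) (ltac:(lra) : 0 <= 1 <= 1) t1.
have dg := der_comp (fl_g fl (W 1 t)) dW.
have dr := fl_rd fl t1.
have E : r' t = S (W 1 t) * (1 * r' t * V 1 t + U 1 t).
  apply: der_uniq dr _; apply: der_ext dg.
  near=> s; rewrite (fl_end fl) //; near: s; exact: lt_nbhsr.
move: E; rewrite -[S _]opprK -(fl_bdry fl t1) => E.
by rewrite mulrDr {1}mulr1 {1}E; ring.
Unshelve. all: by end_near. Qed.

Let sq (x t : R) := Num.sqrt (1 + V x t ^+ 2).
Let sq0 x t : 0 < sq x t.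
Proof. by rewrite sqrtr_gt0; have := sqr_ge0 (V x t); lra. Qed.
Let sq2 x t : sq x t ^+ 2 = 1 + V x t ^+ 2.
Proof. by rewrite sqr_sqrtr //; have := sqr_ge0 (V x t); lra. Qed.
Let csq : jcont sq.
Proof.
have cV := fl_Vc fl.
by apply: (jcont_comp1 (f := Num.sqrt)); [exact: sqrt_continuous|jc].
Qed.
Let csqV : jcont (fun x t => (sq x t)^-1).
Proof. by apply: jcontV => // x t; rewrite gt_eqF. Qed.

Let dsq (v : R -> R) (t dv : R) : is_derive t 1 v dv ->
  is_derive t 1 (fun s => Num.sqrt (1 + v s ^+ 2)) (v t * dv / Num.sqrt (1 + v t ^+ 2)).
Proof.
move=> d; have p0 : 0 < 1 + v t ^+ 2 by have := sqr_ge0 (v t); lra.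
have s0 : Num.sqrt (1 + v t ^+ 2) != 0 by rewrite gt_eqF // sqrtr_gt0.
by der_eq; [der|rewrite /=; field].
Qed.

Let dq (v : R -> R) (t dv : R) : is_derive t 1 v dv ->
  is_derive t 1 (fun s => v s / Num.sqrt (1 + v s ^+ 2)) (dv / Num.sqrt (1 + v t ^+ 2) ^+ 3).
Proof.
move=> d; have p0 : 0 < 1 + v t ^+ 2 by have := sqr_ge0 (v t); lra.
have s0 : Num.sqrt (1 + v t ^+ 2) != 0 by rewrite gt_eqF // sqrtr_gt0.
have s2 : Num.sqrt (1 + v t ^+ 2) ^+ 2 = 1 + v t ^+ 2 by rewrite sqr_sqrtr // ltW.
have d2 := derV (f := fun s => Num.sqrt (1 + v s ^+ 2)) s0 (dsq d).
der_eq; first by der.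
set q := Num.sqrt _ in s0 s2 *; rewrite /=.
transitivity (dv * (q ^+ 2 - v t ^+ 2) / q ^+ 3); first by field.
by rewrite s2; field.
Qed.

(** The function [A] constructed here is the area of the disk, up to the measure of the
    unit sphere.  Its first variation is minus the integral of the squared mean
    curvature, with no boundary term.  As [y^(n-1) V / sqrt (1 + V^2)] is the integral
    from [0] to [y] of the mean curvature times [s^(n-1) ds], the dissipation of area
    bounds the slope at every point off the axis. *)
Lemma area_dissipation : exists A A' : R -> R,
  [/\ forall t : R, 1 < t -> is_derive t 1 A (A' t), forall t, 0 <= A t &
    forall x t, 1 < t -> 0 < x <= 1 ->
      n%:R * (x * r t) ^+ (n - 2) * (V x t ^+ 2 / (1 + V x t ^+ 2)) <= - A' t].
Proof.
have [m nE] : exists m, n = m.+2 by exists (n - 2)%N; have := fl_n fl; case: (n) => // -[|k] //= _; rewrite subn2.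
have cr := fl_rc fl; have cr' := fl_r'c fl.
have cV := fl_Vc fl; have cV1 := fl_V1c fl; have cU := fl_Uc fl; have cZ := fl_Zc fl.
have r0 := fl_r0 fl.
pose a x t := r t * (x * r t) ^+ m.+1 * sq x t.
pose a' x t := r' t * (x * r t) ^+ m.+1 * sq x t
  + r t * (m.+1%:R * (x * r t) ^+ m * (x * r' t)) * sq x t
  + r t * (x * r t) ^+ m.+1 * (V x t * (x * r' t * V1 x t + Z x t) * (sq x t)^-1).
have ca : jcont a by rewrite /a; jc; exact: csq.
have ca' : jcont a' by rewrite /a'; jc; (exact: csq || exact: csqV).
have da (x t : R) : 0 < x < 1 -> 1 < t -> is_derive t 1 (a x) (a' x t).
  move=> xb t1; have dV := dsq (fl_Vt fl xb t1); have dr := fl_rd fl t1.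
  rewrite /a /a' /sq; der_eq; first by der.
  by rewrite /=; ring.
exists (fun t => \int[mu]_(x in `[0, 1]) a x t), (fun t => \int[mu]_(x in `[0, 1]) a' x t).
split.
- by move=> t t1; apply: integral_param.
- move=> t; apply: Rintegral_ge0 => x; rewrite /= in_itv /= => xb.
  have rt := r0 t; have st := sq0 x t.
  apply: mulr_ge0; last exact: ltW.
  apply: mulr_ge0; first exact: ltW.
  by apply: exprn_ge0; apply: mulr_ge0; [lra|exact: ltW].
move=> X t t1 Xb.
have [H [dH ->]] := antiderivative (jcont_x t ca').
have rt := r0 t.
pose y x := x * r t.
(* a' = G' - j, where G is the boundary flux of the first variation and j is the
   density of the dissipation *)
pose q x := V x t / sq x t.
pose G x := r' t / r t * y x ^+ m.+2 * sq x t + y x ^+ m.+1 * (U x t * q x).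
(* By U^2 >= 2 la U - la^2, j dominates the derivative P' of P; this la maximises the
   resulting bound P X. *)
pose la := m.+2%:R * q X / y X.
pose P x := 2 * la * (y x ^+ m.+1 * q x) - la ^+ 2 / m.+2%:R * y x ^+ m.+2.
pose j x := r t * y x ^+ m.+1 * (U x t ^+ 2 / sq x t).
pose P' x := r t * y x ^+ m.+1 * (2 * la * U x t / sq x t - la ^+ 2).
have y0 x : 0 < x -> 0 < y x by move=> x0; apply: mulr_gt0.
have pde x : 0 < x < 1 ->
    V1 x t = (U x t - m.+1%:R * (V x t / y x)) * sq x t ^+ 2.
  move=> xb; rewrite sq2 (fl_pde fl xb t1) nE -/(y x).
  have p0 : 1 + V x t ^+ 2 != 0 by rewrite gt_eqF //; have := sqr_ge0 (V x t); lra.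
  have yx : y x != 0 by rewrite gt_eqF //; apply: y0; lra.
  rewrite (_ : m.+2%:R - 1 = m.+1%:R); last by rewrite -[m.+2]addn1 natrD addrK.
  by field; apply/andP.
have dq' (x : R) : 0 < x < 1 -> is_derive x 1 q (r t * V1 x t / sq x t ^+ 3).
  by move=> xb; exact: dq (fl_Vx fl xb t1).
have dflux (x : R) : 0 < x < 1 ->
    is_derive x 1 (fun x => y x ^+ m.+1 * q x) (r t * y x ^+ m.+1 * U x t / sq x t).
  move=> xb; have d := dq' x xb; rewrite /y; der_eq; first by der.
  have yx : x * r t != 0 by rewrite gt_eqF //; apply: y0; lra.
  have sx : sq x t != 0 by rewrite gt_eqF.
  have [x0 rx] : x != 0 /\ r t != 0 by split; rewrite gt_eqF //; lra.
  by rewrite (pde x xb) /q /y /= exprS; field; rewrite sx rx.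
have dP (x : R) : 0 < x < 1 -> is_derive x 1 P (P' x).
  move=> xb; have d := dflux x xb; rewrite /P.
  have dy : is_derive x 1 (fun x => y x ^+ m.+2) (m.+2%:R * y x ^+ m.+1 * r t).
    by rewrite /y; der_eq; [der|rewrite /=; ring].
  der_eq; first by der.
  have m0 : m.+2%:R != 0 :> R by rewrite pnatr_eq0.
  have m2 : 2 + m%:R != 0 :> R by rewrite -natrD pnatr_eq0.
  have sx : sq x t != 0 by rewrite gt_eqF.
  by rewrite /P'; field; apply/andP.
have dG (x : R) : 0 < x < 1 -> is_derive x 1 G (a' x t + j x).
  move=> xb; have d := dflux x xb; have dU := fl_Ux fl xb t1.
  have dS := dsq (fl_Vx fl xb t1).
  have -> : G = (fun x => r' t / r t * (y x ^+ m.+2 * sq x t) + U x t * (y x ^+ m.+1 * q x)).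
    by apply/funext => z; rewrite /G; ring.
  have dy : is_derive x 1 (fun x => y x ^+ m.+2) (m.+2%:R * y x ^+ m.+1 * r t).
    by rewrite /y; der_eq; [der|rewrite /=; ring].
  rewrite /sq; der_eq; first by der.
  cbv beta; rewrite -!/(sq x t).
  have sx : sq x t != 0 by rewrite gt_eqF.
  have yx : x * r t != 0 by rewrite gt_eqF //; apply: y0; lra.
  have rx : r t != 0 by rewrite gt_eqF.
  have m21 : m.+2%:R = m.+1%:R + 1 :> R by rewrite -[m.+2]addn1 natrD.
  by rewrite /a' /j /q /y m21 !exprS; field; rewrite sx rx.
have jP x : 0 < x < 1 -> 0 <= j x - P' x.
  move=> xb; have yx := y0 x ltac:(lra); have sx := sq0 x t.
  have s1 : 1 <= sq x t.
    by rewrite -[leLHS]sqrtr1 ler_wsqrtr //; have := sqr_ge0 (V x t); lra.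
  have -> : j x - P' x = r t * y x ^+ m.+1 * ((U x t - la) ^+ 2 / sq x t + la ^+ 2 * (1 - (sq x t)^-1)).
    by rewrite /j /P'; field; rewrite gt_eqF.
  apply: mulr_ge0; first by apply: mulr_ge0; [lra|apply: exprn_ge0; lra].
  apply: addr_ge0; first by apply: divr_ge0; [exact: sqr_ge0|lra].
  apply: mulr_ge0; first exact: sqr_ge0.
  by rewrite subr_ge0 invf_le1.
have j0 x : 0 < x < 1 -> 0 <= j x.
  move=> xb; have yx := y0 x ltac:(lra); have sx := sq0 x t.
  apply: mulr_ge0; first by apply: mulr_ge0; [lra|apply: exprn_ge0; lra].
  by apply: divr_ge0; [exact: sqr_ge0|lra].
have cG : continuous G.
  have J : jcont (fun x s => r' t / r t * (x * r t) ^+ m.+2 * sq x s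
      + (x * r t) ^+ m.+1 * (U x s * (V x s * (sq x s)^-1))).
    by jc; (exact: csq || exact: csqV).
  exact: jcont_x t J.
have cP : continuous P.
  have J : jcont (fun x s => 2 * la * ((x * r t) ^+ m.+1 * (V x s * (sq x s)^-1))
      - la ^+ 2 / m.+2%:R * (x * r t) ^+ m.+2).
    by jc; exact: csqV.
  exact: jcont_x t J.
have cGf x : {for x, continuous G} by exact: cG.
have cPf x : {for x, continuous P} by exact: cP.
have cHf x : 0 <= x <= 1 -> {for x, continuous H} by move=> /dH /der_cont.
have B1 : G X - H X <= G 1 - H 1.
  apply: (@der_ge_incr _ (fun x => G x - H x) j) => [|x xb|x xb|x xb]; first lra.
  - by apply: continuousB; [exact: cGf|apply: cHf; lra].
  - have dGx := dG x ltac:(lra); have dHx := dH x ltac:(lra).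
    by der_eq; [der|ring].
  - by apply: j0; lra.
have B2 : G 0 - H 0 - P 0 <= G X - H X - P X.
  apply: (@der_ge_incr _ (fun x => G x - H x - P x) (fun x => j x - P' x)) => [|x xb|x xb|x xb]; first lra.
  - apply: continuousB; last exact: cPf.
    by apply: continuousB; [exact: cGf|apply: cHf; lra].
  - have dGx := dG x ltac:(lra); have dHx := dH x ltac:(lra); have dPx := dP x ltac:(lra).
    by der_eq; [der|ring].
  - by apply: jP; lra.
have G0 : G 0 = 0 by rewrite /G /y mul0r !expr0n /= !(mulr0, mul0r) addr0.
have P0 : P 0 = 0 by rewrite /P /y mul0r !expr0n /= !(mulr0, mul0r) subrr.
have s1 : sq 1 t != 0 by rewrite gt_eqF.
have rt0 : r t != 0 by rewrite gt_eqF.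
have G1 : G 1 = 0.
  have := end_velocity t1; rewrite -sq2 => E.
  have -> : G 1 = r t ^+ m.+1 / sq 1 t * (r' t * sq 1 t ^+ 2 + U 1 t * V 1 t).
    by rewrite /G /q /y mul1r [_ ^+ m.+2]exprS; field; apply/andP.
  by rewrite E mulr0.
have yX : y X != 0 by rewrite gt_eqF //; apply: y0; lra.
have PX : P X = n%:R * (X * r t) ^+ (n - 2) * (V X t ^+ 2 / (1 + V X t ^+ 2)).
  rewrite -sq2 nE subn2 /= -/(y X) /P /la /q !exprS.
  have sX : sq X t != 0 by rewrite gt_eqF.
  have m0 : m.+2%:R != 0 :> R by rewrite pnatr_eq0.
  have m2 : 2 + m%:R != 0 :> R by rewrite -natrD pnatr_eq0.
  by field; rewrite sX m2 yX.
by rewrite -PX; lra.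
Qed.

End Energy.

Section GoodTimes.
Context {R : realType}.

(** A nonnegative nonincreasing quantity has a small rate of decrease at some time of
    every late interval of length [tau]. *)
Lemma small_dissipation (A A' : R -> R) (T0 tau eta : R) : 0 < tau -> 0 < eta ->
  (forall t : R, T0 < t -> is_derive t 1 A (A' t)) -> (forall t, 0 <= A t) ->
  (forall t, T0 < t -> A' t <= 0) ->
  exists2 T, T0 < T & forall t, T <= t -> exists2 s, t < s < t + tau & - A' s <= eta.
Proof.
move=> tau0 eta0 dA A0 A'0.
have decr s t : T0 < s -> s <= t -> A t <= A s.
  rewrite le_eqVlt => s0 /predU1P[<-//|st].
  have [c cb E] := mvt_der st (fun z zb => dA z (ltac:(lra))).
  have : A' c * (t - s) <= 0 by apply: mulr_le0_ge0; [apply: A'0; lra|lra].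
  by lra.
pose E := [set A t | t in [set t | T0 < t]].
have iE : has_inf E.
  split; first by exists (A (T0 + 1)), (T0 + 1) => //=; lra.
  by exists 0 => _ [t _ <-].
have [_ [T /= T0T <-] AT] := inf_adherent (mulr_gt0 eta0 tau0) iE.
exists T => // t Tt.
have [c cb Ec] := mvt_der (ltac:(lra) : t < t + tau) (fun z zb => dA z (ltac:(lra))).
exists c => //.
have low : inf E <= A (t + tau).
  by apply: ge_inf; [case: iE|exists (t + tau) => //=; lra].
have up := decr T t T0T Tt.
have : (- A' c) * tau <= eta * tau by lra.
by rewrite ler_pM2r.
Qed.

End GoodTimes.

(** * Motion of the boundary *)

Section Hold.
Context {R : realType}.
Variables (n : nat) (g S r r' : R -> R) (W V V1 V2 U Z : R -> R -> R).
Hypothesis fl : flow n g S r r' W V V1 V2 U Z.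

(** Suppose that at time [s] the disk rises at most [kk] above its boundary height [h] and
    that the slope of the cylinder is at most [kk] there.  The barrier
    [h + 2 kk + b (y - y0)^2 / 2 + ga (t - s)], with vertex [y0] at distance [et] from the
    cylinder, meets the cylinder with a slope larger than the bound [sg] of the slope of
    the cylinder between the heights [h] and [h + k]; it prevents the boundary height
    from rising by more than [k] during the time [tau]. *)
Lemma boundary_height_barrier (lo hi K s tau k kk et sg b ga : R) : 2 <= s ->
  0 < K -> 0 < k -> 0 < kk -> 0 < et < r s -> 0 < b -> n%:R * b <= ga -> 0 < ga ->
  K * k + kk < sg -> sg * k <= et / 2 -> b * (et / 2) = 2 * sg ->
  2 * kk + b / 2 * (3 / 2 * et) ^+ 2 + ga * tau < k ->
  (forall t, 2 <= t -> lo <= W 1 t <= hi) ->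
  (forall z z', lo <= z <= hi -> lo <= z' <= hi -> `|S z - S z'| <= K * `|z - z'|) ->
  (forall x, 0 <= x <= 1 -> W x s <= W 1 s + kk) -> `|S (W 1 s)| <= kk ->
  forall t, s <= t <= s + tau -> W 1 t <= W 1 s + k.
Proof.
move=> s2 K0 k0 kk0 ets b0 bga ga0 Kk sgk bet small Wb lip osc Ss t tb.
have Kk0 : 0 < K * k by apply: mulr_gt0.
rewrite leNgt; apply/negP => Wt.
(* t1 is the first time at which the boundary has risen by k; up to t1 the bounds sg
   on the slope and sg * k on the change of radius hold *)
have [] := @first_contact R (fun _ t => W 1 t - W 1 s - k) s t.
- have cW := jcont_t 1 (fl_Wc fl).
  by jc; apply: jcont1t.
- by move=> x _; rewrite subrr sub0r oppr_lt0.
- by exists 0, t; split; [rewrite lexx ler01|case/andP: tb => -> _; rewrite lexx|lra].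
move=> _ [t1 [_ t1b /eqP + _ neg]]; rewrite subr_eq0 subr_eq => /eqP Et1.
have hb := Wb s s2.
have {neg} Wle s' : s <= s' <= t1 -> W 1 s' <= W 1 s + k.
  move=> s'b; have [->|ne] := eqVneq s' t1; first by rewrite Et1 addrC.
  have := neg 0 s'; rewrite lexx ler01 lt_neqAle ne /= => /(_ isT s'b) H; lra.
have {tb Wt} t1s : t1 - s <= tau by case/andP: tb => _; case/andP: t1b => _; lra.
have [h Eh] : {h | W 1 s = h} by exists (W 1 s).
rewrite !Eh in Ss hb Et1 osc.
have {}Wle s' : s <= s' <= t1 -> W 1 s' <= h + k by rewrite -Eh; exact: Wle.
have slope z : lo <= z <= hi -> h <= z <= h + k -> `|S z| < sg.
  move=> zb zh; have := lip z h zb hb; rewrite (@ger0_norm _ (z - h)); last lra.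
  have : K * (z - h) <= K * k by rewrite ler_pM2l //; lra.
  by have := ler_normD (S z - S h) (S h); rewrite subrK; lra.
have rad s' : s <= s' <= t1 -> h <= W 1 s' -> `|r s' - r s| <= et / 2.
  move=> s'b Wh.
  have [s1 s'1] : 1 < s /\ 1 < s' by lra.
  have Ws' := Wb s' ltac:(lra); have Wk := Wle s' s'b.
  rewrite (fl_end fl s1) (fl_end fl s'1) Eh.
  have [->|ne] := eqVneq (W 1 s') h; first by rewrite subrr normr0; lra.
  have hW : h < W 1 s' by rewrite lt_neqAle eq_sym ne.
  have [c cb ->] := mvt_der hW (fun z _ => fl_g fl z).
  have Sc := slope c ltac:(lra) ltac:(lra).
  apply: le_trans sgk; rewrite normrM (@ger0_norm _ (W 1 s' - h)); last by rewrite subr_ge0 ltW.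
  by apply: ler_pM => //; [rewrite subr_ge0 ltW|exact: ltW|rewrite lerBlDl].
pose y0 := r s - et.
have y00 : 0 < y0 by rewrite /y0; lra.
have by0 : 0 < b * y0 by apply: mulr_gt0.
have dy s' : r s' - y0 = r s' - r s + et by rewrite /y0; ring.
clearbody y0.
have sqr y : h + 2 * kk + b / 2 * y0 ^+ 2 - ga * s + - b * y0 * y + b / 2 * y ^+ 2
   = h + 2 * kk + b / 2 * (y - y0) ^+ 2 - ga * s by field.
have sq0 y : 0 <= b / 2 * (y - y0) ^+ 2.
  by apply: mulr_ge0; [lra|exact: sqr_ge0].
have bar x : 0 <= x <= 1 ->
    W x t1 < h + 2 * kk + b / 2 * (x * r t1 - y0) ^+ 2 - ga * s + ga * t1.
  move=> xb; rewrite -sqr.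
  apply: (quadratic_barrier fl (T0 := s) (T1 := t1) _ _ (ltW b0) bga); rewrite ?mulNr //; try lra.
    move=> z zb; have := osc z zb; have := sqr (z * r s); have := sq0 (z * r s); lra.
  move=> s' s'b E.
  have E' : W 1 s' = h + 2 * kk + b / 2 * (r s' - y0) ^+ 2 + ga * (s' - s).
    by rewrite E -mulNr sqr; ring.
  have gas : 0 <= ga * (s' - s) by apply: mulr_ge0; lra.
  have Wh : h <= W 1 s' by have := sq0 (r s'); lra.
  have := slope _ (Wb s' ltac:(lra)) ltac:(have := Wle s' ltac:(lra); lra).
  have := rad s' ltac:(lra) Wh.
  rewrite ler_norml ltr_norml => rr ss.
  have : b * (et / 2) <= b * (r s' - y0) by rewrite ler_pM2l // dy; lra.
  by lra.
have := bar 1 ltac:(lra); rewrite mul1r => {bar sqr}.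
have h1 : h <= W 1 t1 by rewrite Et1; lra.
have := rad t1 ltac:(lra) h1; rewrite ler_norml => rr.
have : b / 2 * (r t1 - y0) ^+ 2 <= b / 2 * (3 / 2 * et) ^+ 2.
  by rewrite ler_pM2l ?ler_sqr ?nnegrE ?dy; lra.
have : ga * (t1 - s) <= ga * tau by rewrite ler_pM2l.
by rewrite Et1; lra.
Qed.

(** The boundary height rises by at most [ka] during a fixed time [tau] after any time at
    which the disk is nearly flat and its boundary slope nearly zero. *)
Lemma boundary_height_rise (lo hi K de ka : R) : 0 < K -> 0 < de -> 0 < ka ->
  (forall t, 2 <= t -> lo <= W 1 t <= hi) -> (forall t, 2 <= t -> de <= r t) ->
  (forall z z', lo <= z <= hi -> lo <= z' <= hi -> `|S z - S z'| <= K * `|z - z'|) ->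
  exists tau k1, [/\ 0 < tau, 0 < k1 & forall s, 2 <= s ->
    (forall x, 0 <= x <= 1 -> W x s <= W 1 s + k1) -> `|S (W 1 s)| <= k1 ->
    forall t, s <= t <= s + tau -> W 1 t <= W 1 s + ka].
Proof.
move=> K0 de0 ka0 Wb rb lip.
(* The rise b (3 et / 2)^2 / 2 of the barrier at the cylinder is of order K k et; taking
   et below 1 / (36 K) makes it at most k / 4, whatever k. *)
have [et [et0 etd etK]] : exists et, [/\ 0 < et, et <= de / 2 & K * et <= 1 / 36].
  exists (Num.min (de / 2) (1 / (36 * K))); split.
  - by rewrite lt_min; apply/andP; split; [lra|apply: divr_gt0; lra].
  - by rewrite ge_min lexx.
  - rewrite mulrC -ler_pdivlMr // ge_min; apply/orP; right.
    by rewrite invfM mulrA.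
have [k [k0 kka k1 kK]] : exists k, [/\ 0 < k, k <= ka, k <= 1 & K * k <= et / 4].
  exists (Num.min ka (Num.min 1 (et / (4 * K)))); split.
  - by rewrite !lt_min ka0 ltr01 /=; apply: divr_gt0; lra.
  - by rewrite ge_min lexx.
  - by rewrite !ge_min lexx orbT.
  - rewrite mulrC -ler_pdivlMr // !ge_min; apply/orP; right; apply/orP; right.
    by rewrite invfM mulrA.
have Kk0 : 0 < K * k by apply: mulr_gt0.
have [kk [kk0 kk8 kkK]] : exists kk, [/\ 0 < kk, kk <= k / 8 & kk < K * k].
  exists (Num.min (K * k / 2) (k / 8)); split.
  - by rewrite lt_min; apply/andP; split; lra.
  - by rewrite ge_min lexx orbT.
  - by rewrite gt_min; apply/orP; left; lra.
have [b [b0 bet brise]] : exists b, [/\ 0 < b, b * (et / 2) = 2 * (2 * (K * k)) &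
    b / 2 * (3 / 2 * et) ^+ 2 <= k / 4].
  have et0' : et != 0 by rewrite gt_eqF.
  exists (8 * (K * k) / et); split; first by apply: divr_gt0; lra.
    by field.
  have -> : 8 * (K * k) / et / 2 * (3 / 2 * et) ^+ 2 = 9 * (K * et) * k by field.
  have : 9 * (K * et) * k <= 9 * (1 / 36) * k by rewrite ler_pM2r //; lra.
  by lra.
have ga0 : 0 < n%:R * b by rewrite mulr_gt0 // ltr0n; apply: leq_trans (fl_n fl).
exists (k / (8 * (n%:R * b))), kk; split => //; first by rewrite divr_gt0 // mulr_gt0.
move=> s s2 osc Ss t tb.
suff : W 1 t <= W 1 s + k by lra.
apply: (boundary_height_barrier (et := et) (sg := 2 * (K * k)) (ga := n%:R * b) s2 K0 k0 kk0 _ b0 (lexx _) ga0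
  _ _ bet _ Wb lip osc Ss tb).
- by have := rb s s2; lra.
- by lra.
- have : K * k * k <= K * k * 1 by rewrite ler_pM2l.
  by lra.
- have -> : n%:R * b * (k / (8 * (n%:R * b))) = k / 8.
    have n0 : n%:R != 0 :> R by rewrite pnatr_eq0 -lt0n; apply: leq_trans (fl_n fl).
    by field; rewrite n0 gt_eqF.
  by lra.
Qed.

End Hold.

(** * Decay of the slope *)

Section Convergence.
Context {R : realType}.
Variables (n : nat) (g S r r' : R -> R) (W V V1 V2 U Z : R -> R -> R).
Hypothesis fl : flow n g S r r' W V V1 V2 U Z.

Lemma slope_bound (eps K la T Rm : R) : 1 < T -> 0 < eps -> 0 < K -> 0 < la ->
  (forall t, T <= t -> r t <= Rm) -> la * Rm ^+ 2 <= n%:R - 1 ->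
  (forall t, T <= t -> `|S (W 1 t)| <= eps) ->
  (forall x, 0 <= x <= 1 -> `|V x T| < K) ->
  forall x t, 0 <= x <= 1 -> T <= t -> `|V x t| <= eps + K * expR (- la * (t - T)).
Proof.
move=> T1 e0 K0 la0 rR laR Sb Vb x t xb tb.
have up := slope_above fl T1 e0 K0 la0 rR laR _ _ xb tb.
have dn := slope_above (flow_reflect fl) T1 e0 K0 la0 rR laR _ _ xb tb.
rewrite ler_norml lerNl dn ?up // => [t' /Sb|z /Vb|t' /Sb|z /Vb].
- by rewrite ler_norml; lra.
- by rewrite ltr_norml; lra.
- by rewrite !opprK ler_norml; lra.
- by rewrite ltr_norml; lra.
Qed.

Lemma slope_at_time T : exists2 K, 0 < K & forall x, 0 <= x <= 1 -> `|V x T| < K.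
Proof.
have [a aB] := seg_max (jcont_x T (fl_Vc fl)) (ler01 : 0 <= 1 :> R).
have [b bB] := seg_max (jcont_x T (jcontN (fl_Vc fl))) (ler01 : 0 <= 1 :> R).
exists (`|a| + `|b| + 1); first by have := normr_ge0 a; have := normr_ge0 b; lra.
move=> x xb; have := aB x xb; have := bB x xb; rewrite ltr_norml.
by have := ler_norm a; have := ler_norm b; have := normr_ge0 a; have := normr_ge0 b; lra.
Qed.

Lemma exp_small (K la e T : R) : 0 < K -> 0 < la -> 0 < e ->
  exists2 T', T <= T' & forall t, T' <= t -> K * expR (- la * (t - T)) <= e.
Proof.
move=> K0 la0 e0; have Ke : 0 < K / e by rewrite divr_gt0.
have Kel : 0 < K / e / la by rewrite divr_gt0.
exists (T + K / e / la) => [|t tT]; first lra.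
rewrite mulNr expRN ler_pdivrMr ?expR_gt0 //.
have y0 : K / e <= la * (t - T) by rewrite (mulrC la) -ler_pdivrMr //; lra.
have ex := expR_ge1Dx (la * (t - T)).
have -> : K = e * (K / e) by field; rewrite gt_eqF.
by rewrite ler_pM2l //; lra.
Qed.

(** A small dissipation of area makes the whole disk nearly flat.  The estimate of the slope
    degenerates at the axis when [2 < n]; inside the radius [xi * r s] the global
    gradient bound [L] is used instead. *)
Lemma nearly_flat (A' : R -> R) (L de Rm k : R) : 0 < L -> 0 < de -> 0 < Rm -> 0 < k ->
  (forall t, 2 <= t -> de <= r t <= Rm) ->
  (forall x t, 0 <= x <= 1 -> 2 <= t -> `|V x t| <= L) ->
  (forall x t, 1 < t -> 0 < x <= 1 ->
      n%:R * (x * r t) ^+ (n - 2) * (V x t ^+ 2 / (1 + V x t ^+ 2)) <= - A' t) ->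
  exists2 eta, 0 < eta & forall s, 2 <= s -> - A' s <= eta ->
    (forall x, 0 <= x <= 1 -> `|W x s - W 1 s| <= k) /\ `|S (W 1 s)| <= k.
Proof.
move=> L0 de0 Rm0 k0 rb VL dis.
have [xi [xi0 xi1 xik]] : exists xi, [/\ 0 < xi, xi < 1 & Rm * L * xi <= k / 2].
  have RL : 0 < Rm * L by rewrite mulr_gt0.
  exists (Num.min (1 / 2) (k / 2 / (Rm * L))); split.
  - by rewrite lt_min; apply/andP; split; [lra|apply: divr_gt0 => //; lra].
  - by rewrite gt_min; apply/orP; left; lra.
  - by rewrite mulrC -ler_pdivlMr // ge_min lexx orbT.
have [e [e0 ek eR]] : exists e, [/\ 0 < e, e <= k & Rm * e <= k / 2].
  exists (Num.min k (k / 2 / Rm)); split.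
  - by rewrite lt_min k0 /=; apply: divr_gt0 => //; lra.
  - by rewrite ge_min lexx.
  - by rewrite mulrC -ler_pdivlMr // ge_min lexx orbT.
have p0 : 0 < n%:R * (xi * de) ^+ (n - 2).
  rewrite mulr_gt0 ?exprn_gt0 ?mulr_gt0 // ltr0n.
  by apply: leq_trans (fl_n fl).
have L1 : 0 < 1 + L ^+ 2 by have := sqr_ge0 L; lra.
exists (n%:R * (xi * de) ^+ (n - 2) * (e ^+ 2 / (1 + L ^+ 2))).
  by rewrite mulr_gt0 // divr_gt0 // exprn_gt0.
move=> s s2 As; have s1 : 1 < s by lra.
have Ve x : xi <= x <= 1 -> `|V x s| <= e.
  move=> xb; have x0 : 0 < x <= 1 by lra.
  have := le_trans (dis x s s1 x0) As.
  have V0 := sqr_ge0 (V x s).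
  have VL2 : V x s ^+ 2 <= L ^+ 2.
    by rewrite -(real_normK (num_real (V x s))) ler_sqr ?nnegrE // ?VL //; lra.
  have q0 : 0 <= V x s ^+ 2 / (1 + V x s ^+ 2) by rewrite divr_ge0 //; lra.
  have pp : n%:R * (xi * de) ^+ (n - 2) <= n%:R * (x * r s) ^+ (n - 2).
    apply: ler_wpM2l => //; apply: lerXn2r; rewrite ?nnegrE.
    - by rewrite mulr_ge0 // ltW.
    - by rewrite mulr_ge0 // ?(ltW (fl_r0 fl s)) //; lra.
    - by apply: ler_pM; [lra|lra|lra|have := rb s s2; lra].
  have := ler_wpM2r q0 pp => /le_trans /[apply].
  rewrite ler_pM2l // ler_pdivrMr; last lra.
  move=> H; have H2 : V x s ^+ 2 <= e ^+ 2.
    apply: le_trans H _; rewrite mulrAC ler_pdivrMr //.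
    by rewrite ler_wpM2l // ?sqr_ge0 //; lra.
  by rewrite -ler_sqr ?nnegrE ?normr_ge0 ?(ltW e0) // real_normK // num_real.
split; last first.
  rewrite -normrN -(fl_bdry fl s1); apply: le_trans (Ve 1 _) ek; lra.
have mv a b c : 0 <= a -> a <= b -> b <= 1 -> 0 <= c ->
    (forall z, a < z < b -> `|V z s| <= c) -> `|W b s - W a s| <= Rm * c * (b - a).
  move=> a0; rewrite le_eqVlt => /predU1P[->|ab] b1 c0 Vc.
    by rewrite !subrr normr0 mulr0.
  have [z zb ->] := mvtT ab (fun z zb => fl_Wx fl (ltac:(lra) : 0 < z < 1) s1) (jcont_x s (fl_Wc fl)).
  rewrite normrM (@gtr0_norm _ (b - a)) ?subr_gt0 //.
  apply: ler_wpM2r; first lra.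
  rewrite normrM (gtr0_norm (fl_r0 fl s)); apply: ler_pM => //.
  - exact: ltW (fl_r0 fl s).
  - by have := rb s s2; lra.
  - exact: Vc.
have hi x : xi <= x <= 1 -> `|W 1 s - W x s| <= k / 2.
  move=> /andP[x0 x1]; apply: le_trans (mv x 1 e _ x1 (lexx _) (ltW e0) _) _.
  - by lra.
  - by move=> z zb; apply: Ve; lra.
  - have : Rm * e * (1 - x) <= Rm * e * 1 by rewrite ler_pM2l ?mulr_gt0 //; lra.
    by lra.
move=> x xb; have [xix|xxi] := leP xi x.
  by rewrite distrC; apply: le_trans (hi x _) _; lra.
have H1 := hi xi ltac:(lra).
have H2 : `|W xi s - W x s| <= k / 2.
  apply: le_trans (mv x xi L _ (ltW xxi) (ltW xi1) (ltW L0) _) _.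
  - by lra.
  - by move=> z zb; apply: VL; lra.
  - have : Rm * L * (xi - x) <= Rm * L * xi by rewrite ler_pM2l ?mulr_gt0 //; lra.
    by lra.
have -> : W x s - W 1 s = - (W 1 s - W xi s) - (W xi s - W x s) by ring.
apply: le_trans (ler_normB _ _) _; rewrite normrN; lra.
Qed.

(** The boundary slope tends to zero: at times of small dissipation it is small, and the
    boundary height hardly moves between such times. *)
Lemma boundary_slope_vanishes (lo hi K L de Rm : R) (A A' : R -> R) :
  0 < K -> 0 < L -> 0 < de -> 0 < Rm ->
  (forall t, 2 <= t -> lo <= W 1 t <= hi) ->
  (forall t, 2 <= t -> de <= r t <= Rm) ->
  (forall z z', lo <= z <= hi -> lo <= z' <= hi -> `|S z - S z'| <= K * `|z - z'|) ->
  (forall x t, 0 <= x <= 1 -> 2 <= t -> `|V x t| <= L) ->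
  (forall t : R, 1 < t -> is_derive t 1 A (A' t)) -> (forall t, 0 <= A t) ->
  (forall t, 1 < t -> A' t <= 0) ->
  (forall x t, 1 < t -> 0 < x <= 1 ->
      n%:R * (x * r t) ^+ (n - 2) * (V x t ^+ 2 / (1 + V x t ^+ 2)) <= - A' t) ->
  forall e, 0 < e -> exists2 T, 2 <= T & forall t, T <= t -> `|S (W 1 t)| <= e.
Proof.
move=> K0 L0 de0 Rm0 Wb1 rb lip VL dA A0 A'0 dis e e0.
have deB t : 2 <= t -> de <= r t by move=> /rb /andP[].
have ka0 : 0 < e / 2 / K by rewrite divr_gt0 //; lra.
have [tau1 [k1 [tau10 k10 up]]] := boundary_height_rise fl K0 de0 ka0 Wb1 deB lip.
have [||tau2 [k2 [tau20 k20 dn]]] := boundary_height_rise (flow_reflect fl) (lo := - hi) (hi := - lo) K0 de0 ka0 _ deB.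
- by move=> t t2; have := Wb1 t t2; lra.
- move=> z z' zb z'b.
  have -> : - S (- z) - - S (- z') = - (S (- z) - S (- z')) by ring.
  have -> : z - z' = - (- z - - z') by ring.
  by rewrite !normrN; apply: lip; lra.
pose tau := Num.min tau1 tau2.
have tau0 : 0 < tau by rewrite lt_min tau10.
have t1 : tau <= tau1 by rewrite ge_min lexx.
have t2 : tau <= tau2 by rewrite ge_min lexx orbT.
pose k := Num.min (e / 2) (Num.min k1 k2).
have k0 : 0 < k by rewrite !lt_min k10 k20 !andbT; lra.
have kk1 : k <= k1 by rewrite !ge_min lexx orbT.
have kk2 : k <= k2 by rewrite !ge_min lexx !orbT.
have ke : k <= e / 2 by rewrite ge_min lexx.
clearbody k tau.
have [eta eta0 flat] := nearly_flat L0 de0 Rm0 k0 rb VL dis.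
have [T T1 good] := small_dissipation tau0 eta0 dA A0 A'0.
exists (Num.max T 2 + tau); first by rewrite -[leLHS]addr0 lerD ?le_max ?lexx ?orbT // ltW.
move=> t tT.
have [tT1 tT2] : T <= t - tau /\ 2 <= t - tau.
  have : Num.max T 2 <= t - tau by lra.
  by rewrite ge_max => /andP[? ?]; split.
have [s /andP[st1 st2] As] := good _ tT1; rewrite subrK in st2.
have s2 : 2 <= s by lra.
have [osc Ss] := flat s s2 As.
have U1 : W 1 t <= W 1 s + e / 2 / K.
  apply: (up s s2); [|by lra|by lra].
  by move=> x /osc; rewrite ler_norml; lra.
have U2 : - W 1 t <= - W 1 s + e / 2 / K.
  apply: (dn s s2); [| |by lra].
  - by move=> x /osc; rewrite ler_norml; lra.
  - by rewrite normrN opprK; lra.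
have := lip (W 1 t) (W 1 s) (Wb1 t ltac:(lra)) (Wb1 s s2).
have : K * `|W 1 t - W 1 s| <= K * (e / 2 / K) by rewrite ler_pM2l // ler_norml; lra.
have -> : K * (e / 2 / K) = e / 2 by field; rewrite gt_eqF.
by have := ler_normD (S (W 1 t) - S (W 1 s)) (S (W 1 s)); rewrite subrK; lra.
Qed.

Hypothesis hpos : forall M, exists2 c, M <= c & 0 < S c.
Hypothesis hneg : forall M, exists2 c, c <= M & S c < 0.

Lemma height_bounded : exists lo hi, forall x t, 0 <= x <= 1 -> 2 <= t -> lo <= W x t <= hi.
Proof.
have [hi hiB] := bounded_above fl hpos.
have [|lo loB] := bounded_above (flow_reflect fl).
  move=> M; have [c cM Sc] := hneg (- M); exists (- c); first lra.
  by rewrite opprK; lra.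
exists (- lo), hi => x t xb tb; have := hiB x t xb tb; have := loB x t xb tb; lra.
Qed.

(** The slope converges to zero uniformly, provided that heights at which the cylinder opens
    upwards, resp. downwards, exist arbitrarily high, resp. low. *)
Theorem slope_vanishes eps : 0 < eps ->
  exists T, forall t, T <= t -> forall x, 0 <= x <= 1 -> `|V x t| <= eps.
Proof.
have [lo [hi Wb]] := height_bounded.
have Wb1 t : 2 <= t -> lo <= W 1 t <= hi by apply: Wb; lra.
have lohi : lo <= hi by have := Wb1 2 (lexx _); lra.
have gc : continuous g by move=> z; exact: der_cont (fl_g fl z).
have [Rm0' RmB'] := seg_max gc lohi.
have rE t : 2 <= t -> r t = g (W 1 t) by move=> t2; apply: (fl_end fl); lra.
have [Rm Rm0 RmB] : exists2 Rm, 0 < Rm & forall t, 2 <= t -> r t <= Rm.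
  exists Rm0'; last by move=> t t2; rewrite rE //; apply: RmB'; exact: Wb1.
  by apply: lt_le_trans (fl_g0 fl lo) (RmB' lo _); rewrite lexx.
have [c _ cB] := EVT_min lohi (continuous_subspaceT (A := `[lo, hi]) gc).
pose de := g c; have de0 : 0 < de := fl_g0 fl c.
have deB t : 2 <= t -> de <= r t.
  by move=> t2; rewrite rE //; apply: cB; rewrite in_itv; exact: Wb1.
have [K K0 lip] := fl_lip fl lo hi.
have [M1 M1B] := seg_max (fl_S fl) lohi.
have [M2 M2B] := seg_max (fun z => continuousN (@fl_S _ _ _ _ _ _ _ _ _ _ _ _ fl z)) lohi.
pose la := (Rm ^+ 2)^-1.
have la0 : 0 < la by rewrite invr_gt0 exprn_gt0.
have laR : la * Rm ^+ 2 <= n%:R - 1.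
  rewrite mulVf ?gt_eqF ?exprn_gt0 //.
  have : @Order.le _ R 2 n%:R by rewrite ler_nat (fl_n fl).
  by lra.
have [L L0 VL] : exists2 L, 0 < L & forall x t, 0 <= x <= 1 -> 2 <= t -> `|V x t| <= L.
  have [K2 K20 K2B] := slope_at_time 2.
  pose M := `|M1| + `|M2| + 1.
  have nn1 := normr_ge0 M1; have nn2 := normr_ge0 M2.
  have n1 := ler_norm M1; have n2 := ler_norm M2.
  have M0 : 0 < M by rewrite /M; lra.
  exists (M + K2); first lra.
  move=> x t xb t2.
  apply: le_trans (slope_bound (ltac:(lra) : 1 < 2) M0 K20 la0 RmB laR _ K2B xb t2) _.
    move=> s s2; have Ws := Wb1 s s2; have := M1B _ Ws; have := M2B _ Ws.
    by rewrite ler_norml /M /=; lra.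
  have : K2 * expR (- la * (t - 2)) <= K2 * 1.
    rewrite ler_pM2l // -[leRHS]expR0 ler_expR mulNr oppr_le0 mulr_ge0 ?(ltW la0) //.
    by rewrite subr_ge0.
  by lra.
have [A [A' [dA A0 dis]]] := area_dissipation fl.
have A'0 t : 1 < t -> A' t <= 0.
  move=> t1; have := dis 1 t t1 ltac:(lra); rewrite mul1r.
  have : 0 <= n%:R * r t ^+ (n - 2) * (V 1 t ^+ 2 / (1 + V 1 t ^+ 2)).
    have V0 := sqr_ge0 (V 1 t).
    apply: mulr_ge0; last by apply: divr_ge0; lra.
    by apply: mulr_ge0 => //; apply: exprn_ge0; exact: ltW (fl_r0 fl t).
  by lra.
have rb t : 2 <= t -> de <= r t <= Rm by move=> tt; rewrite deB // RmB.
have bdry := boundary_slope_vanishes K0 L0 de0 Rm0 Wb1 rb lip VL dA A0 A'0 dis.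
move=> eps0; have e20 : 0 < eps / 2 by lra.
have [T T2 Sb] := bdry _ e20.
have [KT KT0 KTB] := slope_at_time T.
have [T' TT' ex] := exp_small T KT0 la0 e20.
exists T' => t tT' x xb.
apply: le_trans (slope_bound (ltac:(lra) : 1 < T) e20 KT0 la0 _ laR Sb KTB xb _) _.
- by move=> s sT; apply: RmB; lra.
- by lra.
- by have := ex t tT'; lra.
Qed.

End Convergence.

(** * Derivatives relative to a closed interval *)

Section DeriveOn.
Context {R : realType}.

Lemma is_derive_on_epsP (D : set R) (f : R -> R) (x l : R) : is_derive_on D f x l <->
  forall e, 0 < e -> exists2 d, 0 < d &
    forall z, D z -> `|z - x| < d -> `|f z - f x - l * (z - x)| <= e * `|z - x|.
Proof.
split=> H.
  move=> e e0; move/cvgrPdist_le : H => /(_ e e0) [d /= d0 B]; exists d => // z Dz zd.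
  have [->|zx] := eqVneq z x; first by rewrite !subrr mulr0 subr0 !normr0 mulr0.
  have zx0 : 0 < `|z - x| by rewrite normr_gt0 subr_eq0.
  have := B z; rewrite /ball /= distrC => /(_ zd zx Dz) B'.
  have -> : f z - f x - l * (z - x) = - ((l - (f z - f x) / (z - x)) * (z - x)).
    by field; rewrite subr_eq0.
  by rewrite normrN normrM ler_wpM2r // ltW.
apply/(@cvgrPdist_le _ R^o) => e e0.
have [d d0 B] := H e e0; exists d => //= z; rewrite /ball /= distrC => zd zx Dz.
have zx0 : 0 < `|z - x| by rewrite normr_gt0 subr_eq0.
rewrite -(ler_pM2r zx0) -normrM.
suff -> : (l - (f z - f x) / (z - x)) * (z - x) = - (f z - f x - l * (z - x)).
  by rewrite normrN; exact: B.
by field; rewrite subr_eq0.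
Qed.

Lemma is_derive_is_derive_on (D : set R) (f : R -> R) (x l : R) :
  is_derive x 1 f l -> is_derive_on D f x l.
Proof.
move=> /is_derive_epsP H; apply/is_derive_on_epsP => e /H [d d0 B].
by exists d => // z _; exact: B.
Qed.

(** [x] is an accumulation point of [D]; then derivatives relative to [D] at [x] are unique. *)
Definition acc (D : set R) (x : R) :=
  forall d, 0 < d -> exists2 z, D z & z != x /\ `|z - x| < d.

Lemma is_derive_on_uniq (D : set R) (f : R -> R) (x l l' : R) : acc D x ->
  is_derive_on D f x l -> is_derive_on D f x l' -> l = l'.
Proof.
move=> aD /is_derive_on_epsP H /is_derive_on_epsP H'.
apply/eqP; rewrite -subr_eq0 -normr_le0 leNgt; apply/negP => ll.
pose e := `|l - l'| / 4; have e0 : 0 < e by rewrite /e; lra.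
have [d d0 B] := H e e0; have [d' d'0 B'] := H' e e0.
have [|z Dz [zx]] := aD (Num.min d d'); first by rewrite lt_min d0.
rewrite lt_min => /andP[zd zd'].
have b := B z Dz zd; have b' := B' z Dz zd'.
have zx0 : 0 < `|z - x| by rewrite normr_gt0 subr_eq0.
have : `|(l - l') * (z - x)| <= 2 * e * `|z - x|.
  have -> : (l - l') * (z - x) = (f z - f x - l' * (z - x)) - (f z - f x - l * (z - x)) by ring.
  by apply: le_trans (ler_normB _ _) _; lra.
rewrite normrM ler_pM2r // /e; lra.
Qed.

Lemma derive_onE (D : set R) (f : R -> R) (x l : R) : acc D x ->
  is_derive_on D f x l -> derive_on D f x = l.
Proof.
move=> aD H; have PF : ProperFilter (within D x^').
  apply: Build_ProperFilter_ex => P [d /= d0 B].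
  have [z Dz [zx zd]] := aD d d0.
  by exists z; apply: B => //; rewrite /ball /= distrC.
exact/(cvg_lim _ H).
Qed.

Lemma acc_itv (a b x : R) : a < b -> a <= x <= b -> acc `[a, b] x.
Proof.
move=> ab /andP[ax xb] d d0.
have [xb'|bx] := ltP x b.
  exists (Num.min (x + d / 2) b).
    by rewrite /= in_itv /= le_min ge_min lexx !orbT andbT; apply/andP; split; lra.
  have h : x < Num.min (x + d / 2) b by rewrite lt_min xb' andbT; lra.
  split; first by rewrite gt_eqF.
  rewrite gtr0_norm ?subr_gt0 // ltrBlDl gt_min; apply/orP; left; lra.
have -> : x = b by apply/eqP; rewrite eq_le xb.
exists (Num.max (b - d / 2) a).
  by rewrite /= in_itv /= ge_max le_max lexx !orbT /=; apply/andP; split; lra.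
have h : Num.max (b - d / 2) a < b by rewrite gt_max ab andbT; lra.
split; first by rewrite lt_eqF.
rewrite ltr0_norm ?subr_lt0 // opprB ltrBlDl -ltrBlDr lt_max; apply/orP; left; lra.
Qed.

Lemma acc_ray (a x : R) : a <= x -> acc `[a, +oo[ x.
Proof.
move=> ax d d0; exists (x + d / 2); first by rewrite /= in_itv /= andbT; lra.
split; first by apply/eqP; lra.
by rewrite (addrC x) addrK gtr0_norm; lra.
Qed.

Lemma within_comp (T U : topologicalType) (K : set U) (f : U -> R) (phi : T -> U) z :
  {within K, continuous f} -> (forall z, K (phi z)) -> {for z, continuous phi} ->
  {for z, continuous (fun z => f (phi z))}.
Proof.
move=> /subspace_continuousP cf Kphi cphi.
apply: cvg_comp (cf _ (Kphi z)).
move=> P /= wP; have := cphi _ wP.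
rewrite nbhs_simpl /=; apply: filterS => y; apply; exact: Kphi.
Qed.

(** Chain rule along the curve [s |-> (x * r s, s)] for the function [f], whose pull-back is
    [F] and whose partial derivative in the first variable has the continuous
    pull-back [F1].  No extension of [f] outside its domain is involved. *)
Lemma moving_derivative (F F1 : R -> R -> R) (f : R -> R -> R) (r : R -> R)
    (x t l m : R) : 0 < x < 1 -> 1 < t ->
  jcont F -> jcont F1 -> (forall s, 0 < r s) -> is_derive t 1 r m ->
  (forall y s, 0 < y < 1 -> 1 < s -> F y s = f (y * r s) s) ->
  (forall y s : R, 0 < y < 1 -> 1 < s -> is_derive y 1 (F ^~ s) (r s * F1 y s)) ->
  is_derive t 1 (f (x * r t)) l ->
  is_derive t 1 (F x) (x * m * F1 x t + l).
Proof.
move=> x01 t1 cF cF1 r0 dr Ff dF df.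
have rt := r0 t; have cr := der_cont dr.
apply/is_derive_epsP => e e0.
have [d1 d10 B1] := (is_derive_epsP _ _ _).1 df (e / 3) ltac:(lra).
pose k := `|F1 x t| + 1.
have k0 : 0 < k by rewrite /k; have := normr_ge0 (F1 x t); lra.
have [d2 d20 B2] := (is_derive_epsP _ _ _).1 dr (e / 3 / k) ltac:(by apply: divr_gt0; lra).
have [d3 d30 B3] := (is_derive_epsP _ _ _).1 dr 1 ltr01.
pose m1 := `|m| + 1.
have m10 : 0 < m1 by rewrite /m1; have := normr_ge0 m; lra.
have [d4 d40 B4] := jcont_near x t cF1 (ltac:(by apply: divr_gt0; lra) : 0 < e / 3 / m1).
pose y s := x * r t / r s.
have cy : {for t, continuous y}.
  apply: continuousM; first exact: cvg_cst.
  by apply: continuousV => //; rewrite gt_eqF.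
have yt : y t = x by rewrite /y mulfK // gt_eqF.
have [d5 d50 B5] : exists2 d, 0 < d & forall s, `|s - t| < d ->
    `|y s - x| < Num.min d4 (Num.min x (1 - x)).
  have : 0 < Num.min d4 (Num.min x (1 - x)) by rewrite !lt_min d40 /=; lra.
  move/cvgrPdist_lt : cy => /[apply] -[d /= d0 B]; exists d => // s sd.
  by rewrite distrC -[X in X - _]yt; apply: B; rewrite /ball /= distrC.
exists (Num.min d1 (Num.min d2 (Num.min d3 (Num.min d4 (Num.min d5 (t - 1)))))).
  by rewrite !lt_min d10 d20 d30 d40 d50 /=; lra.
move=> s; rewrite !lt_min => /and5P[s1 s2 s3 s4 /andP[s5 s6]].
have sgt1 : 1 < s by move: s6; rewrite ltr_norml => /andP[]; lra.
have rs := r0 s.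
have := B5 s s5; rewrite !lt_min => /and3P[y4 yx y1].
have y01 : 0 < y s < 1 by move: yx y1; rewrite !ltr_norml; lra.
have [c cn cE] : exists2 c, `|c - x| < d4 & F x s - F (y s) s = r s * F1 c s * (x - y s).
  have [//|//|z zb|c cn E] := @mvt_near _ (F ^~ s) (fun z => r s * F1 z s) 0 1 x (y s).
    exact: dF.
  exists c; first exact: le_lt_trans cn y4.
  by rewrite -[LHS]opprB E; ring.
have yE : r s * (x - y s) = x * (r s - r t) by rewrite /y; field; rewrite gt_eqF.
have FE : F x s - F x t = F1 c s * x * (r s - r t) + (f (x * r t) s - f (x * r t) t).
  have -> : f (x * r t) s = F (y s) s.
    by rewrite Ff // /y divfK // gt_eqF.
  rewrite -(Ff x t x01 t1).
  have -> : F x s = F (y s) s + F1 c s * (r s * (x - y s)).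
    by rewrite mulrCA mulrA -cE; ring.
  by rewrite yE; ring.
rewrite FE.
have h1 := B1 s s1; have h2 := B2 s s2; have h3 := B3 s s3; have h4 := B4 c s cn s4.
have rlip : `|r s - r t| <= m1 * `|s - t|.
  have -> : r s - r t = (r s - r t - m * (s - t)) + m * (s - t) by ring.
  by apply: le_trans (ler_normD _ _) _; rewrite normrM /m1 mulrDl addrC lerD2l.
have xn : `|x| <= 1 by case/andP: x01 => x0 x1; rewrite ger0_norm ltW.
have T1 : `|(F1 c s - F1 x t) * x * (r s - r t)| <= e / 3 * `|s - t|.
  rewrite !normrM.
  have : `|F1 c s - F1 x t| * `|x| <= e / 3 / m1 * 1 by apply: ler_pM.
  move=> /ler_pM /(_ rlip) => /(_ (mulr_ge0 (normr_ge0 _) (normr_ge0 _)) (normr_ge0 _)) H.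
  by apply: le_trans H _; rewrite mulr1 mulrA divfK // gt_eqF.
have T2 : `|F1 x t * x * (r s - r t - m * (s - t))| <= e / 3 * `|s - t|.
  rewrite !normrM.
  have : `|F1 x t| * `|x| <= k * 1 by apply: ler_pM => //; rewrite /k lerDl.
  move=> /ler_pM /(_ h2) => /(_ (mulr_ge0 (normr_ge0 _) (normr_ge0 _)) (normr_ge0 _)) H.
  apply: le_trans H _; rewrite mulr1 mulrA (mulrC k) divfK // gt_eqF //.
have -> : F1 c s * x * (r s - r t) + (f (x * r t) s - f (x * r t) t)
    - (x * m * F1 x t + l) * (s - t)
  = (F1 c s - F1 x t) * x * (r s - r t) + F1 x t * x * (r s - r t - m * (s - t))
    + (f (x * r t) s - f (x * r t) t - l * (s - t)) by ring.
apply: le_trans (ler_normD _ _) _.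
apply: le_trans (lerD (ler_normD _ _) (lexx _)) _.
lra.
Qed.

(** Derivatives relative to the closed interval, end points included, from the
    derivative inside and continuity up to the end points. *)
Lemma is_derive_on_segment (F F1 : R -> R) (a x : R) (w : R -> R) : 0 < a ->
  continuous F -> continuous F1 ->
  (forall y : R, 0 < y < 1 -> is_derive y 1 F (a * F1 y)) ->
  (forall y, 0 <= y <= 1 -> w (y * a) = F y) ->
  0 <= x <= 1 -> is_derive_on `[0, a] w (x * a) (F1 x).
Proof.
move=> a0 cF cF1 dF wF xb; apply/is_derive_on_epsP => e e0.
have := cF1 x => /cvgrPdist_le /(_ e e0) [d /= d0 B].
exists (d * a); first exact: mulr_gt0.
move=> z; rewrite /= in_itv /= => zb zd.
have [z' zE] : exists z', z = z' * a by exists (z / a); rewrite divfK // gt_eqF.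
rewrite {}zE in zb zd *.
have z'b : 0 <= z' <= 1.
  case/andP: zb => z0 z1; rewrite -(pmulr_lge0 z' a0) z0 /=.
  by rewrite -(ler_pM2r a0) mul1r.
rewrite -mulrBl normrM (gtr0_norm a0) ltr_pM2r // in zd.
rewrite !wF //.
have [c cd ->] : exists2 c, `|c - x| < d & F z' - F x = a * F1 c * (z' - x).
  have [zx|zx|->] := ltgtP z' x; last by exists x; rewrite !subrr ?normr0 // mulr0.
  - have [c cb E] := mvtT zx (fun s sb => dF s (ltac:(lra))) cF.
    exists c; first by move: zd; rewrite !ltr0_norm; lra.
    by rewrite -[LHS]opprB E; ring.
  - have [c cb E] := mvtT zx (fun s sb => dF s (ltac:(lra))) cF.
    by exists c => //; move: zd; rewrite !gtr0_norm; lra.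
have -> : a * F1 c * (z' - x) - F1 x * (z' * a - x * a) = (F1 c - F1 x) * (z' * a - x * a) by ring.
rewrite normrM ler_wpM2r // distrC; apply: B; by rewrite /ball /= distrC.
Qed.

(** A positive function that is eventually nonincreasing has a limit at infinity. *)
Lemma nonincreasing_limit (g S : R -> R) (M : R) : (forall z : R, is_derive z 1 g (S z)) ->
  (forall z, 0 < g z) -> (forall z, M <= z -> S z <= 0) -> exists l : R, g z @[z --> +oo] --> l.
Proof.
move=> dg g0 S0.
have decr s t : M <= s -> s <= t -> g t <= g s.
  rewrite [s <= t]le_eqVlt => Ms /predU1P[<-//|st].
  have [c cb E] := mvt_der st (fun z _ => dg z).
  have : S c * (t - s) <= 0 by apply: mulr_le0_ge0; [apply: S0; lra|lra].
  by lra.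
pose E := [set g z | z in [set z | M <= z]].
have iE : has_inf E.
  split; first by exists (g M), M => //=.
  by exists 0 => _ [t _ <-]; exact: ltW.
exists (inf E); apply/(@cvgrPdist_le _ R^o) => e e0.
have [_ [T /= MT <-] gT] := inf_adherent e0 iE.
exists T; split; first exact: num_real.
move=> z Tz; have := decr T z MT (ltW Tz).
have : inf E <= g z by apply: ge_inf; [case: iE|exists z => //=; lra].
by move=> h1 h2; rewrite ler0_norm; lra.
Qed.

End DeriveOn.

(** * Solutions of the Neumann problem as flows *)

Section Clamp.
Context {R : realType}.

Lemma near_oo (a b x : R) : a < x < b -> \near x, a < x < b.
Proof.
move=> /andP[ax xb]; near=> z; apply/andP; split; near: z; first exact: lt_nbhsr.
exact: lt_nbhsl.
Unshelve. all: by end_near. Qed.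

(** Projection onto [0, 1]. *)
Definition clamp (x : R) : R := Num.max 0 (Num.min x 1).

Lemma clamp_in x : 0 <= clamp x <= 1.
Proof. by rewrite /clamp le_max lexx /= ge_max ler01 ge_min lexx orbT. Qed.

Lemma clampE x : 0 <= x <= 1 -> clamp x = x.
Proof. by move=> /andP[x0 x1]; rewrite /clamp (min_idPl x1) (max_idPr x0). Qed.

Lemma clamp_cont : continuous clamp.
Proof.
have -> : clamp = (fun _ => 0) \max ((fun x => x) \min (fun _ => 1)) by [].
move=> x; apply: continuous_max; first exact: cvg_cst.
by apply: continuous_min; [exact: cvg_id|exact: cvg_cst].
Qed.

(** Projection onto [1, +oo[.  Starting at time 1 instead of 0 discards the initial
    datum, which is less regular. *)
Definition late (t : R) : R := Num.max t 1.

Lemma late_gt0 t : 0 < late t.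
Proof. by rewrite lt_max ltr01 orbT. Qed.

Lemma lateE t : 1 < t -> late t = t.
Proof. by move=> t1; rewrite /late (max_idPl (ltW t1)). Qed.

Lemma late_cont : continuous late.
Proof.
have -> : late = (fun x => x) \max (fun _ => 1) by [].
by move=> x; apply: continuous_max; [exact: cvg_id|exact: cvg_cst].
Qed.

Lemma late_comp_cont (f : R -> R) : (forall t : R, 0 < t -> derivable f t 1) ->
  continuous (fun t => f (late t)).
Proof.
move=> df t; apply: (continuous_comp (late_cont (x:=t))).
exact/differentiable_continuous/derivable1_diffP/df/late_gt0.
Qed.

End Clamp.

Section Transfer.
Context {R : realType}.
Variables (n : nat) (wS : R -> R) (r0 : R) (w0 r : R -> R) (w : R -> R -> R).
Hypothesis hn : (2 <= n)%N.
Hypothesis hwS : smooth wS.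
Hypothesis hzero : ~ exists z : R, wS z = 0.
Hypothesis hsol : global_smooth_solution n wS r0 w0 r w.

Lemma profile_derive (z : R) : is_derive z 1 wS (derive1 wS z).
Proof. by apply: DeriveDef; [exact: (@hwS 0%N z)|rewrite derive1E]. Qed.

Lemma profile_derive2 (z : R) : is_derive z 1 (derive1 wS) (derive1n 2 wS z).
Proof. by apply: DeriveDef; [exact: (@hwS 1%N z)|rewrite /= derive1E]. Qed.

Lemma profile_slope_cont : continuous (derive1 wS).
Proof. by move=> z; exact: der_cont (profile_derive2 z). Qed.

Lemma profile_gt0 z : 0 < wS z.
Proof.
have cw : continuous wS by move=> x; exact: der_cont (profile_derive x).
have [h hr] : exists h, 0 < wS h.
  have [rb _] := sol_bdry hsol (lexx 0); exists (w (r 0) 0); rewrite -rb.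
  exact: (sol_r_gt0 hsol (lexx 0)).
rewrite ltNge; apply/negP => wz; apply: hzero.
have [zh|hz] := leP z h.
  have [|c _ cE] := @IVT _ wS z h 0 zh (continuous_subspaceT cw); last by exists c.
  by rewrite ge_min wz /= le_max (ltW hr) orbT.
have [|c _ cE] := @IVT _ wS h z 0 (ltW hz) (continuous_subspaceT cw); last by exists c.
by rewrite ge_min wz orbT /= le_max (ltW hr).
Qed.

Lemma profile_slope_lip a b : exists2 K, 0 < K & forall z z', a <= z <= b -> a <= z' <= b ->
  `|derive1 wS z - derive1 wS z'| <= K * `|z - z'|.
Proof.
have [ba|ab] := ltP b a; first by exists 1 => // z z' zb; lra.
have c2 : continuous (derive1n 2 wS).
  by move=> z; exact/differentiable_continuous/derivable1_diffP/hwS.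
have [M MB] := seg_max (fun z => continuous_comp (c2 z) (@norm_continuous _ R^o _)) ab.
exists (`|M| + 1) => [|z z' zb z'b]; first by have := normr_ge0 M; lra.
have key u v : a <= u -> u < v -> v <= b ->
    `|derive1 wS v - derive1 wS u| <= (`|M| + 1) * `|v - u|.
  move=> au uv vb; have [c cb ->] := mvt_der uv (fun z _ => profile_derive2 z).
  rewrite normrM; apply: ler_wpM2r => //.
  have := MB c ltac:(lra); rewrite /=; have := ler_norm M; lra.
have [zz|zz|->] := ltgtP z z'; last by rewrite !subrr normr0 mulr0.
  by rewrite distrC (distrC z); apply: key; lra.
by apply: key; lra.
Qed.

Let rr t := r (late t).
Let rr' t := derive1 r (late t).

Let rd (t : R) : 0 < t -> is_derive t 1 r (derive1 r t).
Proof. by move=> t0; apply: DeriveDef; [exact: (@sol_r_smooth _ _ _ _ _ _ _ hsol 0%N _ t0)|rewrite derive1E]. Qed.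

Let rr0 t : 0 < rr t.
Proof. exact: (sol_r_gt0 hsol (ltW (late_gt0 t))). Qed.

Let rrc : continuous rr.
Proof. by apply: late_comp_cont => t t0; exact: (@sol_r_smooth _ _ _ _ _ _ _ hsol 0%N _ t0). Qed.

Let rr'c : continuous rr'.
Proof. by apply: (late_comp_cont (f := derive1 r)) => t t0; exact: (@sol_r_smooth _ _ _ _ _ _ _ hsol 1%N _ t0). Qed.

Let lateN (t : R) : 1 < t -> \near t, late t = t.
Proof. by move=> t1; near=> s; apply: lateE; near: s; exact: lt_nbhsr. Unshelve. all: by end_near. Qed.

Let rrd (t : R) : 1 < t -> is_derive t 1 rr (rr' t).
Proof.
move=> t1; rewrite /rr' lateE //; have t0 : 0 < t by lra.
apply: der_ext (rd t0); rewrite /rr; have := lateN t1.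
by apply: filterS => s ->.
Qed.

Section Extension.
Variable d : nat -> nat -> R * R -> R.
Let K : set (R * R) := [set p | 0 < p.2 /\ 0 <= p.1 <= r p.2].
Let U : set (R * R) := [set p | 0 < p.2 /\ 0 < p.1 < r p.2].
Hypothesis d00 : forall p, K p -> d 0 0 p = w p.1 p.2.
Hypothesis dK : forall i j, {within K, continuous (d i j)}.
Hypothesis dU : forall i j (y t : R), U (y, t) ->
  is_derive y 1 (fun y' => d i j (y', t)) (d i.+1 j (y, t)) /\
  is_derive t 1 (fun t' => d i j (y, t')) (d i j.+1 (y, t)).

(* pull-back of d i j, made continuous on the whole plane *)
Let D i j x t := d i j (clamp x * rr t, late t).

Let DE i j x t : 0 <= x <= 1 -> 1 < t -> D i j x t = d i j (x * r t, t).
Proof. by move=> xb t1; rewrite /D /rr clampE // lateE. Qed.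

Let Dc i j : jcont (D i j).
Proof.
move=> p; apply: (within_comp (phi := fun p : R * R => (clamp p.1 * rr p.2, late p.2)) (@dK i j)).
  move=> q; split; first exact: late_gt0.
  have /andP[c0 c1] := clamp_in q.1; have := rr0 q.2; rewrite /= -/(rr q.2) => h.
  by rewrite mulr_ge0 // ?(ltW h) //= ler_piMl // ltW.
apply: cont_pair.
  apply: continuousM.
    exact: (jcont1x (@clamp_cont R) (x := p)).
  exact: (jcont1t rrc (x := p)).
exact: (jcont1t (@late_cont R) (x := p)).
Qed.

Let inU x t : 0 < x < 1 -> 1 < t -> U (x * r t, t).
Proof.
move=> /andP[x0 x1] t1; split => /=; first lra.
have rt : 0 < r t by apply: (sol_r_gt0 hsol); lra.
by rewrite mulr_gt0 //= gtr_pMl.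
Qed.

Let Dx i j (x t : R) : 0 < x < 1 -> 1 < t -> is_derive x 1 (D i j ^~ t) (rr t * D i.+1 j x t).
Proof.
move=> x01 t1.
have [dx _] := dU i j (inU x01 t1).
have dm : is_derive x 1 (fun z => z * r t) (r t) by der_eq; [der|rewrite mulr0 add0r mulr1].
rewrite DE //; last lra.
rewrite /rr lateE // mulrC; apply: der_ext (der_comp (f := fun y => d i j (y, t)) (g := fun z => z * r t) dx dm).
have := near_oo x01; apply: filterS => z zb.
by rewrite DE //; lra.
Qed.

Let Dt i j (x t : R) : 0 < x < 1 -> 1 < t ->
  is_derive t 1 (D i j x) (x * rr' t * D i.+1 j x t + D i j.+1 x t).
Proof.
move=> x01 t1; have [_ dt] := dU i j (inU x01 t1).
rewrite [D i j.+1 x t]DE //; last lra.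
apply: (moving_derivative (f := fun y s => d i j (y, s)) x01 t1 (@Dc i j) (@Dc i.+1 j) rr0 (rrd t1)).
- by move=> y s yb s1; rewrite DE // ?/rr ?lateE //; lra.
- by move=> y s yb s1; exact: Dx.
- by rewrite /rr lateE.
Qed.

Let wE x t : 0 <= x <= 1 -> 1 < t -> w (x * r t) t = D 0 0 x t.
Proof.
move=> xb t1; rewrite DE // d00 //; split => /=; first lra.
have rt : 0 < r t by apply: (sol_r_gt0 hsol); lra.
by case/andP: xb => x0 x1; rewrite mulr_ge0 ?(ltW rt) //= ler_piMl // ltW.
Qed.

Let wy (x t : R) : 0 < x < 1 -> 1 < t -> is_derive (x * r t) 1 (w ^~ t) (D 1 0 x t).
Proof.
move=> x01 t1; have [dx _] := dU 0 0 (inU x01 t1).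
rewrite DE //; last lra.
apply: der_ext dx.
have rt : 0 < r t by apply: (sol_r_gt0 hsol); lra.
near=> z; rewrite d00 //; split => /=; first lra.
suff : 0 < z < r t by move=> /andP[? ?]; rewrite !ltW.
by near: z; apply: near_oo; have [_] := inU x01 t1.
Unshelve. all: by end_near. Qed.

Let rgt0 t : 1 < t -> 0 < r t.
Proof. by move=> t1; apply: (sol_r_gt0 hsol); lra. Qed.

Let scale y t : 1 < t -> 0 < y < r t -> exists2 x, 0 < x < 1 & y = x * r t.
Proof.
move=> t1 /andP[y0 yr]; have rt := rgt0 t1; exists (y / r t); last by rewrite divfK // gt_eqF.
by rewrite divr_gt0 //= ltr_pdivrMr // mul1r.
Qed.

Let wy1 (x t : R) : 0 < x < 1 -> 1 < t -> derive1 (w ^~ t) (x * r t) = D 1 0 x t.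
Proof. by move=> x01 t1; rewrite derive1E; have [_ ->] := wy x01 t1. Qed.

Let wyy (x t : R) : 0 < x < 1 -> 1 < t -> derive1n 2 (w ^~ t) (x * r t) = D 2 0 x t.
Proof.
move=> x01 t1; have [dx _] := dU 1 0 (inU x01 t1).
rewrite DE //; last lra.
rewrite /= derive1E.
suff : is_derive (x * r t) 1 (derive1 (w ^~ t)) (d 2 0 (x * r t, t)) by move=> [_ ->].
apply: der_ext dx.
near=> z.
have zb : 0 < z < r t.
  by near: z; apply: near_oo; have [_] := inU x01 t1.
have [y y01 ->] := scale t1 zb.
by rewrite wy1 // DE //; lra.
Unshelve. all: by end_near. Qed.

Let pde x t : 0 < x < 1 -> 1 < t ->
  D 0 1 x t = D 2 0 x t / (1 + D 1 0 x t ^+ 2) + (n%:R - 1) * (D 1 0 x t / (x * rr t)).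
Proof.
move=> x01 t1; have [y0 yr] := inU x01 t1.
have t0 : 0 <= t by lra.
have H := sol_eq hsol t0 yr; rewrite wyy // wy1 // in H.
have [_ dt] := dU 0 0 (inU x01 t1).
have dw : is_derive t 1 (w (x * r t)) (D 0 1 x t).
  rewrite DE //; last lra.
  apply: der_ext dt.
  have cr : {for t, continuous (fun s => x * r t - r s)}.
    by apply: continuousB; [exact: cvg_cst|apply: der_cont (rd _); lra].
  have [|e e0 B] := cont_at_lt0 cr; first by rewrite subr_lt0; case/andP: yr.
  exists (Num.min e t) => [|s] /=; first by rewrite lt_min e0 /=; lra.
  rewrite /ball /= distrC lt_min => /andP[/B se st]; rewrite d00 //.
  split => /=; first by move: st; rewrite ltr_norml => /andP[]; lra.
  case/andP: yr se => /= ya _; rewrite subr_lt0 => se.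
  by rewrite !ltW.
have := is_derive_on_uniq (acc_ray t0) H (is_derive_is_derive_on `[0, +oo[ dw).
move=> <-; rewrite /rr lateE //.
have := sqr_ge0 (D 1 0 x t) => q.
by rewrite mul1r; congr (_ + _); rewrite mulrCA.
Qed.

Let pdeV x t : 0 < x < 1 -> 1 < t ->
  D 1 1 x t = D 3 0 x t / (1 + D 1 0 x t ^+ 2)
    - 2 * D 1 0 x t * D 2 0 x t ^+ 2 / (1 + D 1 0 x t ^+ 2) ^+ 2
    + (n%:R - 1) * (D 2 0 x t / (x * rr t) - D 1 0 x t / (x * rr t) ^+ 2).
Proof.
move=> x01 t1.
have p0 : 1 + D 1 0 x t ^+ 2 != 0 by rewrite gt_eqF //; have := sqr_ge0 (D 1 0 x t); lra.
have rt := rr0 t; have rt0 : rr t != 0 by rewrite gt_eqF.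
have x0 : x != 0 by rewrite gt_eqF //; lra.
have xr0 : x * rr t != 0 by rewrite mulf_neq0.
have d1 := Dx 1 0 x01 t1; have d2 := Dx 2 0 x01 t1.
have dq : is_derive x 1 (fun z => 1 + D 1 0 z t ^+ 2) (2 * D 1 0 x t * (rr t * D 2 0 x t)).
  by der_eq; [der|rewrite /=; ring].
have dxr : is_derive x 1 (fun z => z * rr t) (rr t) by der_eq; [der|rewrite /=; ring].
have dqV := derV (f := fun z => 1 + D 1 0 z t ^+ 2) p0 dq.
have dxV := derV (f := fun z => z * rr t) xr0 dxr.
have E : is_derive x 1 (fun z => D 2 0 z t / (1 + D 1 0 z t ^+ 2)
    + (n%:R - 1) * (D 1 0 z t / (z * rr t)))
  (rr t * (D 3 0 x t / (1 + D 1 0 x t ^+ 2)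
    - 2 * D 1 0 x t * D 2 0 x t ^+ 2 / (1 + D 1 0 x t ^+ 2) ^+ 2
    + (n%:R - 1) * (D 2 0 x t / (x * rr t) - D 1 0 x t / (x * rr t) ^+ 2))).
  der_eq; first by der.
  by rewrite /=; field; rewrite x0 rt0 p0.
have E' : is_derive x 1 (D 0 1 ^~ t) (rr t * (D 3 0 x t / (1 + D 1 0 x t ^+ 2)
    - 2 * D 1 0 x t * D 2 0 x t ^+ 2 / (1 + D 1 0 x t ^+ 2) ^+ 2
    + (n%:R - 1) * (D 2 0 x t / (x * rr t) - D 1 0 x t / (x * rr t) ^+ 2))).
  apply: der_ext E; have := near_oo x01; apply: filterS => z zb.
  by rewrite pde.
have := der_uniq (Dx 0 1 x01 t1) E'.
exact: (mulfI rt0).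
Qed.

Let slope_on x t : 0 <= x <= 1 -> 1 < t -> is_derive_on `[0, r t] (w ^~ t) (x * r t) (D 1 0 x t).
Proof.
move=> xb t1.
apply: (is_derive_on_segment (F := D 0 0 ^~ t) (F1 := D 1 0 ^~ t)) => //.
- exact: rgt0.
- exact: jcont_x (@Dc 0 0).
- exact: jcont_x (@Dc 1 0).
- by move=> y yb; have := Dx 0 0 yb t1; rewrite {1}/rr lateE.
- by move=> y yb; exact: wE.
Qed.

Let axis t : 1 < t -> D 1 0 0 t = 0.
Proof.
move=> t1; have t0 : 0 <= t by lra.
have [l H] := sol_axis hsol t0.
have rt := rgt0 t1.
have H1 : y * ((1 / y) * derive1 (w ^~ t) y) @[y --> 0^'+] --> 0 * l.
  by apply: cvgM => //; apply: cvg_at_right_filter; exact: cvg_id.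
have H2 : D 1 0 (y / r t) t @[y --> 0^'+] --> D 1 0 0 t.
  have c : {for 0, continuous (fun y : R => D 1 0 (y / r t) t)}.
    apply: (@continuous_comp _ _ _ (fun y : R => y / r t) (D 1 0 ^~ t)).
      by apply: continuousM; [exact: cvg_id|exact: cvg_cst].
    exact: (jcont_x t (@Dc 1 0)).
  by have := cvg_at_right_filter c; rewrite mul0r.
rewrite mul0r in H1.
have E : {near 0^'+, (fun y => y * ((1 / y) * derive1 (w ^~ t) y)) =1
                     (fun y => D 1 0 (y / r t) t)}.
  near=> y.
  have yb : 0 < y < r t.
    by apply/andP; split; near: y; [exact: nbhs_right_gt|exact: nbhs_right_lt].
  have [x x01 ->] := scale t1 yb.
  have x0 : x != 0 by rewrite gt_eqF //; lra.
  by rewrite mulfK ?gt_eqF // wy1 // mulrA div1r divff ?mul1r // mulf_neq0 // gt_eqF.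
have H3 : D 1 0 (y / r t) t @[y --> 0^'+] --> 0.
  by move/near_eq_cvg/cvg_trans : E; apply.
exact: (cvg_unique _ H2 H3).
Unshelve. all: by end_near. Qed.

Let bdry t : 1 < t -> r t = wS (D 0 0 1 t) /\ D 1 0 1 t = - derive1 wS (D 0 0 1 t).
Proof.
move=> t1; have t0 : 0 <= t by lra.
have one : (0 <= (1 : R) <= 1) by lra.
have [rE [p dp]] := sol_bdry hsol t0.
have wr : w (r t) t = D 0 0 1 t by rewrite -(wE one t1) mul1r.
rewrite wr in rE *.
have := slope_on one t1; rewrite mul1r => ds.
have -> : D 1 0 1 t = p.
  apply: is_derive_on_uniq ds dp; apply: acc_itv; first exact: rgt0.
  by rewrite (ltW (rgt0 t1)) lexx.
rewrite /dot /nu_graph /nu_Sigma /=.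
set a := Num.sqrt _; set b := Num.sqrt _ => H.
have a0 : a != 0 by rewrite gt_eqF // sqrtr_gt0; have := sqr_ge0 p; lra.
have b0 : b != 0 by rewrite gt_eqF // sqrtr_gt0; have := sqr_ge0 (derive1 wS (D 0 0 1 t)); lra.
split => //.
have : - (p + derive1 wS (D 0 0 1 t)) = 0.
  have -> : - (p + derive1 wS (D 0 0 1 t)) = (- p / a * (1 / b) + 1 / a * (- derive1 wS (D 0 0 1 t) / b)) * (a * b).
    by field; rewrite a0 b0.
  by rewrite H mul0r.
lra.
Qed.

Lemma flow_of_partial_derivatives : exists r1 r1' W V V1 V2 U1 Z,
  flow n wS (derive1 wS) r1 r1' W V V1 V2 U1 Z /\
  forall x t, 1 < t -> 0 <= x <= 1 -> derive_on `[0, r t] (w ^~ t) (x * r t) = V x t.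
Proof.
exists rr, rr', (D 0 0), (D 1 0), (D 2 0), (D 3 0), (D 0 1), (D 1 1); split.
  split => //.
  - exact: profile_derive.
  - exact: profile_gt0.
  - exact: profile_slope_cont.
  - exact: profile_slope_lip.
  - by move=> x t x01 t1; exact: Dx.
  - by move=> x t x01 t1; exact: Dx.
  - by move=> x t x01 t1; exact: Dx.
  - by move=> x t x01 t1; exact: Dx.
  - by move=> x t x01 t1; exact: Dt.
  - by move=> x t x01 t1; exact: Dt.
  - by move=> t t1; have [] := bdry t1.
  - by move=> t t1; have [+ _] := bdry t1; rewrite /rr lateE.
move=> x t t1 xb; apply: derive_onE; last exact: slope_on.
apply: acc_itv; first exact: rgt0.
have rt := rgt0 t1; case/andP: xb => x0 x1.
by rewrite mulr_ge0 ?(ltW rt) //= ler_piMl // ltW.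
Qed.

End Extension.

(** A global solution of the Neumann problem, seen from time 1 on, is a flow in the sense
    above, and [V] is its slope at all points of the closed disk. *)
Lemma solution_flow : exists r1 r1' W V V1 V2 U1 Z,
  flow n wS (derive1 wS) r1 r1' W V V1 V2 U1 Z /\
  forall x t, 1 < t -> 0 <= x <= 1 -> derive_on `[0, r t] (w ^~ t) (x * r t) = V x t.
Proof.
have [d [d00 dd]] := sol_smooth hsol.
apply: (@flow_of_partial_derivatives d) => //.
- by move=> i j; have [] := dd i j.
- by move=> i j y t yt; have [_] := dd i j; exact.
Qed.

(** If the slope of the profile were nonpositive beyond some height, then the profile
    would be monotone and positive, hence convergent, against either form of the end
    condition. *)
Lemma rising_above : end_condition_pinfty wS ->
  forall M, exists2 c, M <= c & 0 < derive1 wS c.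
Proof.
move=> hp M; apply: contrapT => none.
have S0 z : M <= z -> derive1 wS z <= 0.
  by move=> Mz; rewrite leNgt; apply/negP => S0; apply: none; exists z.
case: hp => [|[al al0 H]].
  by apply; exact: nonincreasing_limit profile_derive profile_gt0 S0.
pose z := Num.max M al + 1.
have [Mz alz] : M <= z /\ al < z.
  have : Num.max M al <= z - 1 by rewrite /z addrK.
  by rewrite ge_max => /andP[? ?]; split; lra.
by have := H z alz; have := S0 z Mz; rewrite pmulr_rgt0; lra.
Qed.

Lemma falling_below : end_condition_ninfty wS ->
  forall M, exists2 c, c <= M & derive1 wS c < 0.
Proof.
move=> hp M; apply: contrapT => none.
have S0 z : z <= M -> 0 <= derive1 wS z.
  by move=> Mz; rewrite leNgt; apply/negP => S0; apply: none; exists z.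
case: hp => [|[al al0 H]].
  apply.
  have dN (z : R) : is_derive z 1 (fun z => wS (- z)) (- derive1 wS (- z)).
    have dN1 : is_derive z 1 (fun z : R => - z) (-1) by der.
    by der_eq; [exact: (der_comp (profile_derive (- z)) dN1)|ring].
  have SN0 z : - M <= z -> - derive1 wS (- z) <= 0.
    by move=> Mz; rewrite oppr_le0; apply: S0; lra.
  have [l Hl] := nonincreasing_limit dN (fun z => profile_gt0 (- z)) SN0.
  by exists l; apply/cvgNy_compNP.
pose z := Num.min M al - 1.
have [Mz alz] : z <= M /\ z < al.
  have : z + 1 <= Num.min M al by rewrite /z subrK.
  by rewrite le_min => /andP[? ?]; split; lra.
have := H z alz; have := S0 z Mz; rewrite nmulr_rgt0; lra.
Qed.

End Transfer.

(** * Convergence to a flat disk *)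

Theorem theorem2p3 (R : realType) (n : nat) (wS : R -> R) (C : R)
    (r0 : R) (w0 : R -> R) (r : R -> R) (w : R -> R -> R)
    (hn : (2 <= n)%N)
    (hwS : smooth wS)
    (hC : 0 <= C)
    (hgraph : forall z : R, C < dot (nu_Sigma wS z) (e1 R))
    (hadm : admissible wS r0 w0)
    (hzero : ~ exists z : R, wS z = 0)
    (hpinfty : end_condition_pinfty wS)
    (hninfty : end_condition_ninfty wS)
    (hsol : global_smooth_solution n wS r0 w0 r w) :
  ereal_sup [set `|derive_on `[0, r t] (w ^~ t) y|%:E | y in `[0, r t]]
    @[t --> +oo] --> 0%:E.
Proof.
have [r1 [r1' [W [V [V1 [V2 [U1 [Z [fl dE]]]]]]]]] := solution_flow hn hwS hzero hsol.
have hpos := rising_above hwS hzero hsol hpinfty.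
have hneg := falling_below hwS hzero hsol hninfty.
pose F (t : R) := ereal_sup [set `|derive_on `[0, r t] (w ^~ t) y|%:E | y in `[0, r t]].
rewrite -[X in X @ _]/F.
have bd (e : R) : 0 < e -> exists2 T, 1 < T & forall t, T <= t -> (0 <= F t <= e%:E)%E.
  move=> e0; have [T HT] := slope_vanishes fl hpos hneg e0.
  exists (Num.max T 2); first by rewrite lt_max; apply/orP; right; lra.
  move=> t; rewrite ge_max => /andP[Tt t2]; have t1 : 1 < t by lra.
  have rt : 0 < r t by apply: (sol_r_gt0 hsol); lra.
  apply/andP; split.
    apply: (@le_trans _ _ `|derive_on `[0, r t] (w ^~ t) 0|%:E); first by rewrite lee_fin.
    by apply: ereal_sup_ubound; exists 0 => //=; rewrite in_itv /= lexx ltW.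
  apply: ge_ereal_sup => _ [y /= + <-]; rewrite in_itv /= => /andP[y0 yr].
  have yE : y = y / r t * r t by rewrite divfK // gt_eqF.
  have xb : 0 <= y / r t <= 1.
    by rewrite divr_ge0 //= ?(ltW rt) // ler_pdivrMr // mul1r.
  by rewrite lee_fin yE dE //; exact: HT.
apply/fine_cvgP; split.
  have [T T1 H] := bd 1 ltr01.
  exists T; split; first exact: num_real.
  move=> t /ltW /H /andP[h0 h1]; rewrite ge0_fin_numE //.
  by apply: le_lt_trans h1 _; rewrite ltry.
apply/(@cvgrPdist_le _ R^o) => e e0.
have [T T1 H] := bd e e0.
exists T; split; first exact: num_real.
move=> t /ltW /H /andP[h0 h1] /=.
rewrite sub0r normrN ger0_norm ?fine_ge0 //.
by rewrite -lee_fin fineK // ge0_fin_numE //; apply: le_lt_trans h1 _; rewrite ltry.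
Qed.
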